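(* Let $n\ge 1$, $p\ge 1$, $t\in(0,1)$, and $\bar\alpha=(\alpha_1,\dots,\alpha_{n+1})$ with $\alpha_i\in(0,1]$ for each $i=1,\dots,n$ and $\alpha_{n+1}\in[-\infty,\infty]$. Suppose that $A,B\subset(\mathbb{R}_+)^{n+1}$ are bounded Borel sets of positive measure such that $A=\tilde A$ and $B=\tilde B$. Put $\gamma=\left(\sum_{i=1}^{n+1}\alpha_i^{-1}\right)^{-1}$. Then, if $\alpha_{n+1}\ge-\left(\sum_{i=1}^n\alpha_i^{-1}\right)^{-1}$, $$V_{n+1}\big((1-t)\otimes_{p,\bar\alpha}A\oplus_{p,\bar\alpha}t\otimes_{p,\bar\alpha}B\big)\ \ge\ M_{p\gamma}^t\big(V_{n+1}(A),V_{n+1}(B)\big),$$ and if $\alpha_{n+1}<-\left(\sum_{i=1}^n\alpha_i^{-1}\right)^{-1}$, $$V_{n+1}\big((1-t)\otimes_{p,\bar\alpha}A\oplus_{p,\bar\alpha}t\otimes_{p,\bar\alpha}B\big)\ \ge\ \sup_{0<\lambda<1}\min\left\{[C_{p,\lambda,t}]^{1/\gamma}V_{n+1}(A),\ [D_{p,\lambda,t}]^{1/\gamma}V_{n+1}(B)\right\}.$$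
   Context: $\mathbb{R}_+=[0,\infty)$ and $V_m$ is Lebesgue measure on $\mathbb{R}^m$. Means: for $a,b\ge0$, $t\in[0,1]$, $\alpha\in[-\infty,\infty]$, if $ab>0$ then $M_\alpha^t(a,b)=[(1-t)a^\alpha+tb^\alpha]^{1/\alpha}$ for $\alpha\ne0,\pm\infty$, $a^{1-t}b^t$ for $\alpha=0$, $\max\{a,b\}$ for $\alpha=+\infty$, $\min\{a,b\}$ for $\alpha=-\infty$; and $M_\alpha^t(a,b)=0$ if $ab=0$. $L_p$ coefficients: with $p^{-1}+q^{-1}=1$ ($1/q=0$ when $p=1$) and $t,\lambda\in(0,1)$, $C_{p,\lambda,t}=(1-t)^{1/p}(1-\lambda)^{1/q}$, $D_{p,\lambda,t}=t^{1/p}\lambda^{1/q}$. For $a,b\ge 0$ with $ab>0$, $M_{p,\alpha}^{(t,\lambda)}(a,b)=[C_{p,\lambda,t}a^\alpha+D_{p,\lambda,t}b^\alpha]^{1/\alpha}$ for $\alpha\neq0,\pm\infty$, $a^{C_{p,\lambda,t}}b^{D_{p,\lambda,t}}$ for $\alpha=0$, $\max\{a,b\}$ for $\alpha=+\infty$, $\min\{a,b\}$ for $\alpha=-\infty$; and it equals $0$ if $ab=0$. $L_{p,\bar\alpha}$-curvilinear summation (for $p\ge1$): $$(1-t)\otimes_{p,\bar\alpha}A\oplus_{p,\bar\alpha}t\otimes_{p,\bar\alpha}B=\bigcup_{0<\lambda<1}\left\{\left(M_{p,\alpha_1}^{(t,\lambda)}(x_1,y_1),\dots,M_{p,\alpha_{n+1}}^{(t,\lambda)}(x_{n+1},y_{n+1})\right):(x_1,\dots,x_{n+1})\in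 A,\ (y_1,\dots,y_{n+1})\in B\right\}.$$ Compression: for a bounded Borel set $A\subset\mathbb{R}^n\times\mathbb{R}_+$ and $x\in\mathbb{R}^n$ write $x+\mathbb{R}_+=\{(x,s):s\ge0\}$; then $\tilde A=\{(x,r)\in\mathbb{R}^n\times\mathbb{R}_+:\ A\cap(x+\mathbb{R}_+)\ne\emptyset,\ 0\le r\le V_1(A\cap(x+\mathbb{R}_+))\}$. Degenerate exponents are read by continuity: $1/(\pm\infty)=0$; $\gamma=0$ if $\alpha_{n+1}=0$; $\gamma=-\infty$ if $\sum_{i=1}^{n+1}\alpha_i^{-1}=0$. *)

(* Defs.v *)
From HB Require Import structures.
From mathcomp Require Import all_boot all_order all_algebra.
From mathcomp Require Import all_classical all_reals all_analysis.
Set Implicit Arguments.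
Unset Strict Implicit.
Unset Printing Implicit Defensive.
Import Order.TTheory GRing.Theory Num.Theory.
Import numFieldNormedType.Exports.
Local Open Scope classical_set_scope.
Local Open Scope ring_scope.

Section cons_measure.
Local Open Scope ereal_scope.
Context {R : realType} (m : nat).
Variable mu : {sigma_finite_measure set (m.-tuple R) -> \bar R}.

Definition cons_pair (z : R * m.-tuple R) : m.+1.-tuple R :=
  [tuple of z.1 :: z.2].

Lemma measurable_cons_pair : measurable_fun [set: R * m.-tuple R] cons_pair.
Proof. exact: measurable_cons. Qed.

Definition cons_measure : set (m.+1.-tuple R) -> \bar R :=
  pushforward (@lebesgue_measure R \x mu) cons_pair.

Let cons_measure0 : cons_measure set0 = 0.
Proof. by rewrite /cons_measure /pushforward preimage_set0 measure0. Qed.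

Let cons_measure_ge0 A : 0 <= cons_measure A.
Proof.
rewrite /cons_measure /pushforward; exact: (measure_ge0 (lebesgue_measure \x mu)).
Qed.

Let cons_measure_sigma_additive : semi_sigma_additive cons_measure.
Proof.
move=> F mF tF mUF; rewrite /cons_measure /pushforward preimage_bigcup.
apply: measure_semi_sigma_additive.
- by move=> n; rewrite -[X in measurable X]setTI; exact: measurable_cons_pair.
- apply/trivIsetP => /= i j _ _ ij; rewrite -preimage_setI.
  by move/trivIsetP : tF => /(_ _ _ _ _ ij) ->//; rewrite preimage_set0.
- by rewrite -preimage_bigcup -[X in measurable X]setTI;
    exact: measurable_cons_pair.
Qed.

HB.instance Definition _ := isMeasure.Build _ _ _ cons_measure
  cons_measure0 cons_measure_ge0 cons_measure_sigma_additive.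

Let cons_measure_sigma_finite : sigma_finite setT cons_measure.
Proof.
have /sigma_finiteP[F [TF ndF Foo]] := sigma_finiteT (@lebesgue_measure R).
have /sigma_finiteP[G [TG ndG Goo]] := sigma_finiteT mu.
pose uncons (x : m.+1.-tuple R) : R * m.-tuple R := (thead x, behead_tuple x).
have consK : cancel cons_pair uncons.
  by move=> [a x]; congr pair => //; apply: val_inj.
have munc : measurable_fun setT uncons.
  apply/measurable_fun_pairP; split.
    exact: measurable_tnth.
  exact: measurable_behead.
exists (fun k => uncons @^-1` (F k `*` G k)).
  apply/seteqP; split => // x _.
  have [i _ Fi] : (\bigcup_k F k) (thead x) by rewrite -TF.
  have [j _ Gj] : (\bigcup_k G k) (behead_tuple x) by rewrite -TG.
  exists (maxn i j) => //; split => /=.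
    by move: Fi; exact/subsetPset/ndF/leq_maxl.
  by move: Gj; exact/subsetPset/ndG/leq_maxr.
move=> k; have [mFk Fk] := Foo k; have [mGk Gk] := Goo k; split.
  rewrite -[X in measurable X]setTI; apply: munc => //.
  exact: measurableX.
rewrite /cons_measure /pushforward -comp_preimage.
rewrite (_ : uncons \o cons_pair = id); last first.
  by apply/funext => z /=; exact: consK.
by rewrite preimage_id product_measure1E// lte_mul_pinfty// ge0_fin_numE.
Qed.

HB.instance Definition _ := Measure_isSigmaFinite.Build _ _ _ cons_measure
  cons_measure_sigma_finite.

End cons_measure.

(* The product Lebesgue measure on the Borel sets of R^n: the library's
   sigma-algebra on [n.-tuple R], generated by the coordinate projections, is
   the Borel one. *)
Fixpoint borel_volume (R : realType) (n : nat) :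
    {sigma_finite_measure set (n.-tuple R) -> \bar R} :=
  match n with
  | 0 => \d_[tuple]
  | m.+1 => cons_measure (borel_volume R m)
  end.

Section volume.
Local Open Scope ereal_scope.
Context {R : realType}.

(* V_n, defined on all subsets of R^n as the outer measure of [borel_volume];
   it agrees with Lebesgue measure on every Lebesgue-measurable set. Borel sets
   alone would not do: a curvilinear sum of Borel sets is analytic, hence
   Lebesgue measurable, but in general it is not Borel. *)
Definition volume (n : nat) : set (n.-tuple R) -> \bar R :=
  (borel_volume R n)^*%mu.

Lemma volume_Borel (n : nat) (A : set (n.-tuple R)) :
  measurable A -> volume A = borel_volume R n A.
Proof. exact: measurable_mu_extE. Qed.

Lemma measurable_box (n : nat) (F : 'I_n -> set R) :
  (forall i, measurable (F i)) ->
  measurable [set x : n.-tuple R | forall i, F i (tnth x i)].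
Proof.
move=> mF; have -> : [set x : n.-tuple R | forall i, F i (tnth x i)] =
    \bigcap_(i in [set: 'I_n]) ((fun x : n.-tuple R => tnth x i) @^-1` F i).
  by apply/seteqP; split => x /= xF i; [move=> _; exact: xF | exact: xF].
apply: fin_bigcap_measurable => // i _.
by rewrite -[X in measurable X]setTI; exact: measurable_tnth.
Qed.

Lemma volume_box (n : nat) (F : 'I_n -> set R) :
  (forall i, measurable (F i)) ->
  volume [set x : n.-tuple R | forall i, F i (tnth x i)] =
  \prod_(i < n) lebesgue_measure (F i).
Proof.
move=> mF; rewrite volume_Borel; last exact: measurable_box.
elim: n => [|m IH] in F mF *.
  rewrite big_ord0 /= diracE mem_set//= => i.
  by case: i => -[].
rewrite big_ord_recl /= /cons_measure /pushforward.
have -> : cons_pair (m := m) @^-1` [set x | forall i, F i (tnth x i)] =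
    F ord0 `*` [set x | forall i, F (lift ord0 i) (tnth x i)].
  apply/seteqP; split => -[a x] /=.
    move=> aF; split; first exact: (aF ord0).
    by move=> i; have := aF (lift ord0 i); rewrite tnthS.
  move=> [a0 xF] i; have [j ->|->//] := unliftP ord0 i.
  by rewrite tnthS; exact: xF.
have mF' i : measurable (F (lift ord0 i)) by [].
rewrite product_measure1E; [|exact: mF|exact: (measurable_box mF')].
by rewrite -(IH _ mF').
Qed.

Definition bounded_tuples (n : nat) (A : set (n.-tuple R)) : Prop :=
  exists M : R, forall x, A x -> forall i, (`|tnth x i| <= M)%R.

Lemma volume_bounded (n : nat) (A : set (n.-tuple R)) :
  bounded_tuples A -> volume A \is a fin_num.
Proof.
move=> [M AM]; pose K (_ : 'I_n) : set R := `[(- M)%R, M]%classic.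
have mK i : measurable (K i) by exact: measurable_itv.
have AK : A `<=` [set x | forall i, K i (tnth x i)].
  by move=> x Ax i; rewrite /K /= in_itv /= -ler_norml; exact: AM.
rewrite ge0_fin_numE; last exact: mu_ext_ge0.
apply: (@le_lt_trans _ _ (volume [set x | forall i, K i (tnth x i)])).
  exact: le_mu_ext.
rewrite volume_box// ltey_eq prode_fin_num// => i _.
by rewrite lebesgue_measure_itv /=; case: ifP.
Qed.

End volume.

Section means.
Context {R : realType}.
Implicit Types (a b c d p t l : R) (x : \bar R).

Definition weighted_mean c d x a b : R :=
  if a * b == 0 then 0 else
  match x with
  | r%:E => if r == 0 then a `^ c * b `^ d
            else (c * a `^ r + d * b `^ r) `^ r^-1
  | +oo%E => Num.max a b
  | -oo%E => Num.min a b
  end.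

Definition power_mean t x a b : R := weighted_mean (1 - t) t x a b.

(* The conjugate exponent enters only through 1/q = 1 - 1/p. *)
Definition lp_coefC p l t : R := (1 - t) `^ p^-1 * (1 - l) `^ (1 - p^-1).
Definition lp_coefD p l t : R := t `^ p^-1 * l `^ (1 - p^-1).

Definition lp_mean p t l x a b : R :=
  weighted_mean (lp_coefC p l t) (lp_coefD p l t) x a b.

(* 1/0 = +oo and 1/(+oo) = 1/(-oo) = 0; the library's inverse on \bar R has
   instead (-oo)^-1 = -oo. *)
Definition recip x : \bar R := if x is r%:E then (r%:E^-1)%E else 0%E.

(* A zero exponent makes the sum +oo, hence gamma = 0. *)
Definition gamma_exponent (n : nat) (alpha : 'I_n -> \bar R) : \bar R :=
  let s := (\sum_(i < n) recip (alpha i))%E in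
  if s == 0%E then -oo%E else recip s.

End means.

Section sets.
Context {R : realType} (n : nat).

Definition lp_curvilinear_sum (p t : R) (alpha : 'I_n -> \bar R)
    (A B : set (n.-tuple R)) : set (n.-tuple R) :=
  \bigcup_(l in `]0, 1[%classic)
    [set [tuple lp_mean p t l (alpha i) (tnth x i) (tnth y i) | i < n]
      | x in A & y in B].

(* A `&` (x + R_+), as a subset of the line. *)
Definition vertical_section (A : set (n.+1.-tuple R)) (x : n.-tuple R) :
    set R :=
  [set s | 0 <= s /\ A [tuple of rcons x s]].

Definition compression (A : set (n.+1.-tuple R)) : set (n.+1.-tuple R) :=
  [set z | exists x : n.-tuple R, exists r : R,
    [/\ z = [tuple of rcons x r], vertical_section A x !=set0, 0 <= r &
        (r%:E <= lebesgue_measure (vertical_section A x))%E]].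

End sets.

(* Main.v *)
Require Import Defs.
From HB Require Import structures.
From mathcomp Require Import all_boot all_order all_algebra.
From mathcomp Require Import all_classical all_reals all_analysis.
From mathcomp Require Import measurable_realfun ring lra.
Set Implicit Arguments.
Unset Strict Implicit.
Unset Printing Implicit Defensive.
Import Order.TTheory GRing.Theory Num.Theory.
Import numFieldNormedType.Exports.
Local Open Scope classical_set_scope.
Local Open Scope ring_scope.

(** The theorem is an inequality of Borell-Brascamp-Lieb type for sums formed
    coordinate by coordinate with power means. It is proved for one fixed l, with
    arbitrary positive weights c and d in place of the L_p coefficients (of sum 1
    if the last exponent is 0), and l is chosen at the end.

    A set that equals its compression is the region below the graph of a function
    of the first n coordinates, and the means of two vertical segments starting
    at 0 fill the segment up to the mean of their lengths
    ([curvilinear_volume1]). The other n coordinates are added one at a time by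
    Fubini ([curvilinear_volume]). If f, g and h are the volumes of the slices of
    A, of B and of a Borel set G that contains the sum, the inequality in lower
    dimension bounds h at a mean of x and y from below by a functional of f (x)
    and g (y), and the integral of h has to be bounded from below by a similar
    functional of the integrals a and b of f and g. Working with a Borel G that
    contains the sum, and not with the sum itself, keeps all slices measurable;
    the outer measure of the sum is the infimum over such G.

    The inequality on the line ([curvilinear_line]) is proved by transport. Let X
    and Y be the quantile functions of f dx / a and g dy / b on ]0, 1[, and let z
    be the mean, of exponent alpha in ]0, 1], of X and Y. Formally X' = a / f (X)
    and Y' = b / g (Y). As the mean is concave and homogeneous, it is
    superadditive, so the increments of z are at least the means of the
    increments of X and Y, and these are at least the integrals of
    the mean k of a / f (X) and b / g (Y). A map that expands at least at the
    rate k satisfies the change of variables inequality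
    int h >= int_0^1 h (z) k ([expansive_substitution]), and the integrand on the
    right is bounded from below by Hoelder's inequality. Nothing is
    differentiated.

    Hoelder's inequality ([tail_mean_step]) is where the exponents combine: their
    reciprocals add. A power mean stays a power mean if its exponent is
    nonnegative, or if it is negative and the total of the reciprocals stays negative; once
    that total reaches 0, only a minimum survives. This is the dichotomy of the
    theorem. It remains to choose l ([bounds_of_tail_mean_bounds]). For a positive
    gamma the best l in C a^gamma + D b^gamma yields
    ((1 - t) a^(p gamma) + t b^(p gamma))^(1/p), the equality case of Hoelder's
    inequality. For the other power means l = t suffices, the coefficients being
    then 1 - t and t, and for a minimum with positive gamma every l is kept. *)

(** * Weighted power means indexed by the reciprocal of the exponent *)

Section means.
Context {R : realType}.
Implicit Types (a b c d p q s t F G P Q X Y : R) (e : \bar R).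

(** The mean with exponent 1 / s. Slicing off a coordinate adds reciprocals of
    exponents, so that s is the convenient parameter; the weights need not add
    up to 1, which makes the normalisation of the L_p coefficients harmless. *)
Definition wmean c d s a b : R := (c * a `^ s^-1 + d * b `^ s^-1) `^ s.

Lemma wmean_gt0 c d s a b : 0 < c -> 0 < d -> 0 < a -> 0 < b ->
  0 < wmean c d s a b.
Proof.
by move=> c0 d0 a0 b0; rewrite powR_gt0// addr_gt0// mulr_gt0// powR_gt0.
Qed.

Lemma wmean1 c d a b : 0 <= c -> 0 <= d -> 0 <= a -> 0 <= b ->
  wmean c d 1 a b = c * a + d * b.
Proof.
move=> c0 d0 a0 b0; rewrite /wmean invr1 !powRr1//.
by rewrite addr_ge0// mulr_ge0.
Qed.

Lemma wmeanZ c d s k a b : s != 0 -> 0 <= c -> 0 <= d -> 0 <= k -> 0 <= a -> 0 <= b ->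
  wmean c d s (k * a) (k * b) = k * wmean c d s a b.
Proof.
move=> s0 c0 d0 k0 a0 b0; rewrite /wmean !powRM// !(mulrCA _ (k `^ _)) -mulrDr.
rewrite powRM ?powR_ge0 ?addr_ge0 ?mulr_ge0 ?powR_ge0//.
by rewrite -powRrM mulVf// powRr1.
Qed.

(** Hoelder's inequality for the exponents (s + t) / s and (s + t) / t. *)
Lemma wmean_hoelder c d s t F G P Q : 0 < c -> 0 < d -> 0 < s -> 0 < t ->
  0 <= F -> 0 <= G -> 0 <= P -> 0 <= Q ->
  wmean c d (s + t) (F * P) (G * Q) <= wmean c d s F G * wmean c d t P Q.
Proof.
move=> c0 d0 s0 t0 F0 G0 P0 Q0.
have st0 : 0 < s + t by exact: addr_gt0.
have [s1 t1 st1] : [/\ s != 0, t != 0 & s + t != 0] by rewrite !gt_eqF.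
pose p := (s + t) / s; pose q := (s + t) / t.
have p0 : 0 < p by exact: divr_gt0.
have q0 : 0 < q by exact: divr_gt0.
have pV : p^-1 = s / (s + t) by rewrite /p invf_div.
have qV : q^-1 = t / (s + t) by rewrite /q invf_div.
have pq : p^-1 + q^-1 = 1 by rewrite pV qV -mulrDl divff.
have key (w U V : R) : 0 < w -> 0 <= U -> 0 <= V ->
    w * (U * V) `^ (s + t)^-1 =
    (w `^ p^-1 * U `^ (s + t)^-1) * (w `^ q^-1 * V `^ (s + t)^-1).
  move=> w0 U0 V0; rewrite mulrACA -powRD; last by rewrite pq oner_eq0.
  by rewrite pq powRr1 ?(ltW w0)// powRM.
have keyP (w U r k : R) : 0 < w -> 0 <= U -> 0 < r -> r = (s + t) / k -> 0 < k ->
    (w `^ r^-1 * U `^ (s + t)^-1) `^ r = w * U `^ k^-1.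
  move=> w0 U0 r0 rE k0; rewrite powRM ?powR_ge0// -!powRrM mulVf ?gt_eqF//.
  by rewrite powRr1 ?(ltW w0)// rE mulKf.
rewrite /wmean (key c F P)// (key d G Q)//.
have pw (w U r : R) : 0 <= w `^ r * U `^ (s + t)^-1.
  by rewrite mulr_ge0 ?powR_ge0.
have := hoelder2 (pw c F p^-1) (pw d G p^-1) (pw c P q^-1) (pw d Q q^-1) p0 q0 pq.
rewrite !(keyP _ _ p s)// !(keyP _ _ q t)// => /(ge0_ler_powR (ltW st0)) H.
apply: le_trans (H _ _) _.
- by rewrite nnegrE addr_ge0// !mulr_ge0// powR_ge0.
- by rewrite nnegrE mulr_ge0// powR_ge0.
rewrite powRM ?powR_ge0// -!powRrM pV qV.
by rewrite !divfK.
Qed.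

(** For an exponent 1 / s in ]0, 1] the mean is concave and homogeneous, so it
    lies below the tangent plane at (X, Y), which passes through the origin.
    The bound is Hoelder's inequality against the powers of X and Y that make
    it sharp at (X, Y). *)
Lemma wmean_tangent c d s X Y : 0 < c -> 0 < d -> 1 <= s -> 0 < X -> 0 < Y ->
  exists w1 w2, [/\ 0 <= w1, 0 <= w2, wmean c d s X Y = w1 * X + w2 * Y &
    forall p q, 0 <= p -> 0 <= q -> wmean c d s p q <= w1 * p + w2 * q].
Proof.
move=> c0 d0; rewrite le_eqVlt => /predU1P[<-|s1] X0 Y0.
  have [c0' d0'] := (ltW c0, ltW d0).
  exists c, d; split => //; first by rewrite wmean1// ltW.
  by move=> p q p0 q0; rewrite wmean1.
have u0 : 0 < s - 1 by rewrite subr_gt0.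
have s0 : 0 < s by apply: lt_trans s1.
have sX (Z : R) : 0 < Z -> (Z `^ ((s - 1) / s)) `^ (s - 1)^-1 = Z `^ s^-1.
  by move=> Z0; rewrite -powRrM mulrAC divff ?gt_eqF// mul1r.
pose m := c * X `^ s^-1 + d * Y `^ s^-1.
(* The partial derivatives of the mean at (X, Y). *)
exists (m `^ (s - 1) * (c / X `^ ((s - 1) / s))), (m `^ (s - 1) * (d / Y `^ ((s - 1) / s))).
have m0 : 0 < m by rewrite addr_gt0// mulr_gt0// powR_gt0.
have ZX (Z : R) : 0 < Z -> Z / Z `^ ((s - 1) / s) = Z `^ s^-1.
  move=> Z0; rewrite -[X in X / _](powRr1 (ltW Z0)) -powRB ?(gt_eqF Z0) ?implybT//.
  by congr (_ `^ _); field; rewrite gt_eqF.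
split.
- by rewrite mulr_ge0 ?powR_ge0// divr_ge0 ?powR_ge0// ltW.
- by rewrite mulr_ge0 ?powR_ge0// divr_ge0 ?powR_ge0// ltW.
- rewrite -!mulrA -mulrDr ![_^-1 * _]mulrC !ZX// -/m.
  by rewrite -[X in _ * X](powRr1 (ltW m0)) -powRD ?subrK// gt_eqF.
move=> p q p0 q0.
pose U := X `^ ((s - 1) / s); pose V := Y `^ ((s - 1) / s).
have U0 : 0 < U by exact: powR_gt0.
have V0 : 0 < V by exact: powR_gt0.
have [c0' d0'] := (ltW c0, ltW d0).
have [U0' V0'] := (ltW U0, ltW V0).
have pU := divr_ge0 p0 U0'; have qV := divr_ge0 q0 V0'.
have := wmean_hoelder c0 d0 u0 ltr01 U0' V0' pU qV.
rewrite subrK [U * _]mulrC [V * _]mulrC !divfK ?gt_eqF// wmean1//.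
move=> /le_trans; apply; rewrite /wmean !sX// -/m -/U -/V.
rewrite mulrDr le_eqVlt; apply/orP; left; apply/eqP; ring.
Qed.

Lemma wmean_superadditive c d s X Y X' Y' : 0 < c -> 0 < d -> 1 <= s ->
  0 < X -> 0 < Y -> 0 < X' -> 0 < Y' ->
  wmean c d s X Y + wmean c d s X' Y' <= wmean c d s (X + X') (Y + Y').
Proof.
move=> c0 d0 s1 X0 Y0 X'0 Y'0.
have [w1 [w2 [_ _ -> H]]] := wmean_tangent c0 d0 s1 (addr_gt0 X0 X'0) (addr_gt0 Y0 Y'0).
by rewrite !mulrDr addrACA lerD// H// ltW.
Qed.

Lemma ler_wmean c d t P Q P' Q' : 0 < c -> 0 < d -> 0 < t ->
  0 < P -> 0 < Q -> P <= P' -> Q <= Q' -> wmean c d t P Q <= wmean c d t P' Q'.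
Proof.
move=> c0 d0 t0 P0 Q0 PP QQ; rewrite /wmean.
have P'0 := lt_le_trans P0 PP; have Q'0 := lt_le_trans Q0 QQ.
have tV : 0 <= t^-1 by rewrite invr_ge0 ltW.
rewrite ge0_ler_powR ?(ltW t0) ?nnegrE ?addr_ge0 ?mulr_ge0 ?powR_ge0 ?(ltW c0) ?(ltW d0)//.
by rewrite lerD// ler_pM2l// ge0_ler_powR// nnegrE ltW.
Qed.

Lemma wmean_ge c d t P Q : 0 < c -> 0 < d -> 0 < t -> 0 < P -> 0 < Q ->
  c `^ t * P <= wmean c d t P Q /\ d `^ t * Q <= wmean c d t P Q.
Proof.
move=> c0 d0 t0 P0 Q0; rewrite /wmean.
have E w U : 0 < w -> 0 < U -> w `^ t * U = (w * U `^ t^-1) `^ t.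
  move=> w0 U0; rewrite powRM ?powR_ge0 ?(ltW w0)// -powRrM mulVf ?gt_eqF//.
  by rewrite powRr1// ltW.
rewrite !E//; have [c0' d0'] := (ltW c0, ltW d0).
by split; rewrite ge0_ler_powR ?(ltW t0) ?nnegrE ?addr_ge0 ?mulr_ge0 ?powR_ge0//
  ?lerDl ?lerDr ?mulr_ge0 ?powR_ge0.
Qed.

Lemma wmean_neg c d s a b : 0 < a -> 0 < b ->
  wmean c d (- s) a b = (wmean c d s a^-1 b^-1)^-1.
Proof.
move=> a0 b0; rewrite /wmean powRN invrN.
by rewrite -(powR_inv1 (ltW a0)) -(powR_inv1 (ltW b0)) -!powRrM !mulN1r.
Qed.

(** Reverse Hoelder inequality: it is the direct one applied to the reciprocals
    of a and b, because a negative exponent amounts to inverting the arguments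
    and the value of the mean. *)
Lemma wmean_hoelder_neg c d s t F G a b : 0 < c -> 0 < d -> 0 < t -> s + t < 0 ->
  0 < F -> 0 < G -> 0 < a -> 0 < b ->
  wmean c d (s + t) a b <= wmean c d s F G * wmean c d t (a / F) (b / G).
Proof.
move=> c0 d0 t0 st F0 G0 a0 b0.
have st' : 0 < - (s + t) by rewrite oppr_gt0.
have aV : 0 < a^-1 by rewrite invr_gt0.
have bV : 0 < b^-1 by rewrite invr_gt0.
have FV : 0 < F^-1 by rewrite invr_gt0.
have GV : 0 < G^-1 by rewrite invr_gt0.
have aF := divr_gt0 a0 F0; have bG := divr_gt0 b0 G0.
have := wmean_hoelder c0 d0 st' t0 (ltW aV) (ltW bV) (ltW aF) (ltW bG).
rewrite (mulKf (lt0r_neq0 a0)) (mulKf (lt0r_neq0 b0)).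
have -> : - (s + t) + t = - s by ring.
rewrite -[s + t in X in _ -> X]opprK (wmean_neg _ _ _ a0 b0).
rewrite -[s in X in _ -> X]opprK (wmean_neg _ _ _ F0 G0) !opprK.
have := wmean_gt0 (- (s + t)) c0 d0 aV bV; have := wmean_gt0 (- s) c0 d0 FV GV.
move: (wmean c d (- s) _ _) (wmean c d (- (s + t)) _ _) (wmean c d t _ _).
move=> U V W U0 V0 H.
by rewrite ler_pdivlMl// ler_pdivrMr// mulrC.
Qed.

Lemma min_mean_step c d s t F G a b : 0 < c -> 0 < d -> 0 < t ->
  0 < F -> 0 < G -> 0 < a -> 0 < b ->
  Num.min (c `^ (s + t) * a) (d `^ (s + t) * b) <=
  Num.min (c `^ s * F) (d `^ s * G) * wmean c d t (a / F) (b / G).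
Proof.
move=> c0 d0 t0 F0 G0 a0 b0.
have [H1 H2] := wmean_ge c0 d0 t0 (divr_gt0 a0 F0) (divr_gt0 b0 G0).
have E (w U P : R) : 0 < w -> 0 < U -> w `^ (s + t) * P = (w `^ s * U) * (w `^ t * (P / U)).
  move=> w0 U0; rewrite powRD ?(gt_eqF w0) ?implybT//.
  by field; rewrite gt_eqF.
have [_|_] := leP (c `^ s * F) (d `^ s * G).
  by rewrite ge_min (E c F a)// ler_pM2l ?H1// mulr_gt0// powR_gt0.
by rewrite ge_min (E d G b)// ler_pM2l ?H2 ?orbT// mulr_gt0// powR_gt0.
Qed.

Lemma ell_norm_nonincreasing s t U V : 0 < s -> s <= t -> 0 < U -> 0 < V ->
  (U `^ s^-1 + V `^ s^-1) `^ s <= (U `^ t^-1 + V `^ t^-1) `^ t.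
Proof.
move=> s0 st U0 V0; have t0 := lt_le_trans s0 st.
pose T := (U `^ t^-1 + V `^ t^-1) `^ t; rewrite -/T.
have UV0 : 0 < U `^ t^-1 + V `^ t^-1 by rewrite addr_gt0// powR_gt0.
have T0 : 0 < T by rewrite powR_gt0.
have E (X : R) : 0 < X -> 0 <= X `^ t^-1 / (U `^ t^-1 + V `^ t^-1) <= 1 ->
    X `^ s^-1 <= X `^ t^-1 / (U `^ t^-1 + V `^ t^-1) * T `^ s^-1.
  move=> X0 /andP[X1 X2].
  rewrite -ler_pdivrMr ?powR_gt0//.
  have -> : X `^ s^-1 / T `^ s^-1 = (X `^ t^-1 / (U `^ t^-1 + V `^ t^-1)) `^ (t / s).
    rewrite powRM ?powR_ge0 ?invr_ge0 ?(ltW UV0)// -powRrM mulKf ?gt_eqF//.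
    by rewrite -(powR_inv1 (ltW UV0)) -!powRrM mulN1r powRN.
  apply: ge1r_powR; rewrite ?X2 ?andbT ?divr_gt0 ?powR_gt0//.
  by rewrite ler_pdivlMr// mul1r.
have -> : T = (T `^ s^-1) `^ s by rewrite -powRrM mulVf ?gt_eqF// powRr1// ltW.
rewrite ge0_ler_powR ?(ltW s0) ?nnegrE ?addr_ge0 ?powR_ge0//.
apply: (@le_trans _ _ (U `^ t^-1 / (U `^ t^-1 + V `^ t^-1) * T `^ s^-1 +
                       V `^ t^-1 / (U `^ t^-1 + V `^ t^-1) * T `^ s^-1)).
  rewrite lerD// E// divr_ge0 ?powR_ge0 ?(ltW UV0)//= ler_pdivrMr// mul1r.
    by rewrite lerDl powR_ge0.
  by rewrite lerDr powR_ge0.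
by rewrite -mulrDl -mulrDl divff ?gt_eqF// mul1r.
Qed.

(** When the exponents 1 / s < 0 and 1 / t > 0 satisfy 0 <= s + t, the product
    of the two means no longer controls a power mean, but it still controls a
    minimum: after replacing a and b by their lower bounds in terms of that
    minimum, the two factors become l^p norms of the same pair of numbers, and
    these decrease with p. *)
Lemma wmean_min_step c d s t F G a b : 0 < c -> 0 < d -> s < 0 -> 0 <= s + t ->
  0 < F -> 0 < G -> 0 < a -> 0 < b ->
  Num.min (c `^ (s + t) * a) (d `^ (s + t) * b) <=
  wmean c d s F G * wmean c d t (a / F) (b / G).
Proof.
move=> c0 d0 s0 st F0 G0 a0 b0.
have t0 : 0 < t by lra.
have s0' : 0 < - s by lra.
have st' : - s <= t by lra.
set m := Num.min _ _.
have m0 : 0 < m by rewrite lt_min !mulr_gt0 ?powR_gt0.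
have mc : m <= c `^ (s + t) * a by rewrite ge_min lexx.
have md : m <= d `^ (s + t) * b by rewrite ge_min lexx orbT.
clearbody m.
pose U := c `^ (- s) / F; pose V := d `^ (- s) / G.
have U0 : 0 < U by rewrite divr_gt0 ?powR_gt0.
have V0 : 0 < V by rewrite divr_gt0 ?powR_gt0.
have E1 : wmean c d s F G = ((U `^ (- s)^-1 + V `^ (- s)^-1) `^ (- s))^-1.
  rewrite -[s in LHS]opprK wmean_neg// /wmean; congr (_^-1).
  rewrite /U /V !powRM ?powR_ge0 ?invr_ge0 ?(ltW F0) ?(ltW G0)//.
  by rewrite -!powRrM !divff ?gt_eqF// !powRr1 ?ltW.
have E2 : wmean c d t (m * (c `^ (- (s + t)) / F)) (m * (d `^ (- (s + t)) / G)) =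
    m * (U `^ t^-1 + V `^ t^-1) `^ t.
  rewrite wmeanZ ?divr_ge0 ?powR_ge0 ?gt_eqF// ?ltW//; congr (m * _).
  rewrite /wmean; congr (_ `^ _).
  have K (w Z : R) : 0 < w -> 0 < Z ->
      w * (w `^ (- (s + t)) / Z) `^ t^-1 = (w `^ (- s) / Z) `^ t^-1.
    move=> w0 X0; have X0' : 0 <= Z^-1 by rewrite invr_ge0 ltW.
    rewrite !powRM ?powR_ge0// mulrA; congr (_ * _).
    rewrite -!powRrM -[X in X * _](powRr1 (ltW w0)) -powRD ?(gt_eqF w0) ?implybT//.
    by congr (_ `^ _); field; rewrite gt_eqF.
  by rewrite !K.
apply: (@le_trans _ _ (wmean c d s F G *
  wmean c d t (m * (c `^ (- (s + t)) / F)) (m * (d `^ (- (s + t)) / G)))).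
  rewrite {}E1 {}E2 mulrCA ler_peMr ?(ltW m0)//.
  rewrite ler_pdivlMl ?powR_gt0 ?addr_gt0 ?powR_gt0// mulr1.
  exact: ell_norm_nonincreasing.
have W0 := wmean_gt0 s c0 d0 F0 G0; move: (wmean c d s F G) W0 => W W0.
rewrite (ler_pM2l W0).
have K (w U' P : R) : 0 < w -> 0 < U' -> m <= w `^ (s + t) * P ->
    0 < m * (w `^ (- (s + t)) / U') /\ m * (w `^ (- (s + t)) / U') <= P / U'.
  move=> w0 U'0 mP; split; first by rewrite mulr_gt0 ?divr_gt0 ?powR_gt0.
  by rewrite mulrA ler_pM2r ?invr_gt0// powRN ler_pdivrMr ?powR_gt0// mulrC.
have [K1 K2] := K _ _ _ c0 F0 mc; have [K3 K4] := K _ _ _ d0 G0 md.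
exact: (ler_wmean c0 d0 t0 K1 K3 K2 K4).
Qed.

Lemma wmean_ge_geometric c d t P Q : 0 < c -> 0 < d -> c + d = 1 -> 0 < t ->
  0 < P -> 0 < Q -> P `^ c * Q `^ d <= wmean c d t P Q.
Proof.
move=> c0 d0 cd t0 P0 Q0.
have cd' : c^-1^-1 + d^-1^-1 = 1 by rewrite !invrK.
have := conjugate_powR (powR_ge0 (P `^ t^-1) c) (powR_ge0 (Q `^ t^-1) d) _ _ cd'.
rewrite !invr_gt0 => /(_ c0 d0).
rewrite [X in _ <= X](_ : _ = c * P `^ t^-1 + d * Q `^ t^-1); last first.
  have K (w Z : R) : 0 < w -> 0 <= Z -> (Z `^ w) `^ w^-1 / w^-1 = w * Z.
    by move=> w0 Z0; rewrite -powRrM divff ?gt_eqF// invrK powRr1// mulrC.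
  have K1 := K c _ c0 (powR_ge0 P t^-1); have K2 := K d _ d0 (powR_ge0 Q t^-1).
  by rewrite -[in RHS]K1 -[in RHS]K2.
rewrite -!powRrM.
move: (ltW t0) => t0' /(ge0_ler_powR t0'); rewrite !nnegrE => H.
have {}H := H _ _.
rewrite /wmean; apply: le_trans (H _ _).
- rewrite powRM ?powR_ge0// -!powRrM.
  have -> : t^-1 * c * t = c by field; rewrite gt_eqF.
  by have -> : t^-1 * d * t = d by field; rewrite gt_eqF.
- by rewrite mulr_ge0 ?powR_ge0.
- by rewrite addr_ge0// mulr_ge0 ?powR_ge0 ?ltW.
Qed.

(** The functional of two volumes that bounds the sum from below when the last
    coordinate carries the exponent e and the reciprocals of the other exponents
    add up to S. For e < 0 the power mean degenerates into a minimum as soon as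
    the total 1 / e + S of the reciprocals reaches 0. *)
Definition tail_mean c d e S a b : R :=
  match e with
  | +oo%E => if S == 0 then Num.max a b else wmean c d S a b
  | -oo%E => Num.min (c `^ S * a) (d `^ S * b)
  | r%:E => if r == 0 then a `^ c * b `^ d
            else if (r < 0) && (0 <= r^-1 + S)
            then Num.min (c `^ (r^-1 + S) * a) (d `^ (r^-1 + S) * b)
            else wmean c d (r^-1 + S) a b
  end.

(** One more coordinate, of exponent 1 / t, turns S into S + t. Here F and G
    stand for the sizes of two slices and a / F, b / G for the lengths over which
    such slices have to be spread to fill the volumes a and b. *)
Lemma tail_mean_step c d e S t F G a b : 0 < c -> 0 < d ->
  (e = 0%E -> c + d = 1) -> 0 <= S -> 0 < t ->
  0 < F -> 0 < G -> 0 < a -> 0 < b ->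
  tail_mean c d e (S + t) a b <=
  tail_mean c d e S F G * wmean c d t (a / F) (b / G).
Proof.
move=> c0 d0 ecd S0 t0 F0 G0 a0 b0.
have hoelder s : 0 < s ->
    wmean c d (s + t) a b <= wmean c d s F G * wmean c d t (a / F) (b / G).
  move=> s0; have aF := divr_gt0 a0 F0; have bG := divr_gt0 b0 G0.
  have := wmean_hoelder c0 d0 s0 t0 (ltW F0) (ltW G0) (ltW aF) (ltW bG).
  by rewrite ![_ * (_ / _)]mulrC !divfK ?gt_eqF.
case: e ecd => [r| |] ecd /=; last exact: min_mean_step.
- case: eqVneq ecd => [->|r0 _].
    move=> /(_ erefl) cd.
    have H := wmean_ge_geometric c0 d0 cd t0 (divr_gt0 a0 F0) (divr_gt0 b0 G0).
    have Fc0 : 0 < F `^ c * G `^ d by rewrite mulr_gt0// powR_gt0.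
    apply: le_trans (ler_wpM2l (ltW Fc0) H).
    have K (w Z U : R) : 0 < Z -> 0 < U -> U `^ w * (Z / U) `^ w = Z `^ w.
      by move=> Z0 U0; rewrite -powRM ?divr_ge0 ?(ltW Z0) ?(ltW U0)// mulrC divfK ?gt_eqF.
    by rewrite mulrACA !K.
  rewrite addrA; have [rn|rp] := ltP r 0 => /=; last first.
    by apply: hoelder; rewrite ltr_pwDl// invr_gt0 lt_neqAle eq_sym r0.
  have rVn : r^-1 < 0 by rewrite invr_lt0.
  have [rSt|rSt] := leP 0 (r^-1 + S + t); have [rS|rS] := leP 0 (r^-1 + S).
  - exact: min_mean_step.
  - exact: wmean_min_step.
  - by have := lt_le_trans rSt (addr_ge0 rS (ltW t0)); rewrite ltxx.
  - exact: wmean_hoelder_neg.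
- rewrite gt_eqF ?ltr_wpDl//; case: eqVneq => [->|S1]; last first.
    by apply: hoelder; rewrite lt_neqAle eq_sym S1.
  rewrite add0r; set m := Num.max F G.
  have m0 : 0 < m by rewrite lt_max F0.
  have aF := divr_gt0 a0 F0; have bG := divr_gt0 b0 G0.
  rewrite -(wmeanZ (lt0r_neq0 t0) (ltW c0) (ltW d0) (ltW m0) (ltW aF) (ltW bG)).
  apply: ler_wmean => //.
    by rewrite mulrCA ler_peMr ?(ltW a0)// ler_pdivlMr// mul1r le_max lexx.
  by rewrite mulrCA ler_peMr ?(ltW b0)// ler_pdivlMr// mul1r le_max lexx orbT.
Qed.

Lemma tail_mean0 c d e a b : 0 < a -> 0 < b ->
  tail_mean c d e 0 a b = weighted_mean c d e a b.
Proof.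
move=> a0 b0; rewrite /weighted_mean mulf_eq0 !gt_eqF//=.
case: e => [r| |] /=.
- case: eqVneq => // r0; rewrite addr0 invr_ge0.
  have -> : (r < 0) && (0 <= r) = false by rewrite leNgt andbN.
  by rewrite /wmean invrK.
- by rewrite eqxx.
- by rewrite !powRr0 !mul1r.
Qed.

Lemma weighted_meanZ c d e k a b : 0 < c -> 0 < d -> (e = 0%E -> c + d = 1) ->
  0 < k -> 0 < a -> 0 < b ->
  weighted_mean c d e (k * a) (k * b) = k * weighted_mean c d e a b.
Proof.
move=> c0 d0 ecd k0 a0 b0; rewrite -!tail_mean0 ?mulr_gt0//.
case: e ecd => [r| |] ecd /=.
- case: eqVneq ecd => [-> /(_ erefl) cd|r0 _].
    rewrite !powRM ?(ltW k0) ?(ltW a0) ?(ltW b0)// mulrACA -powRD ?cd ?oner_eq0//.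
    by rewrite powRr1// ltW.
  rewrite addr0 invr_ge0.
  have -> : (r < 0) && (0 <= r) = false by rewrite leNgt andbN.
  have rV0 : r^-1 != 0 by rewrite invr_eq0.
  exact: wmeanZ rV0 (ltW c0) (ltW d0) (ltW k0) (ltW a0) (ltW b0).
- by rewrite eqxx maxr_pMr// ltW.
- by rewrite !powRr0 !mul1r minr_pMr// ltW.
Qed.

Lemma weighted_mean_gt0 c d e a b : 0 < c -> 0 < d -> 0 < a -> 0 < b ->
  0 < weighted_mean c d e a b.
Proof.
move=> c0 d0 a0 b0; rewrite /weighted_mean mulf_eq0 !gt_eqF//=.
case: e => [r| |]; rewrite ?lt_max ?lt_min ?a0 ?b0//.
by case: eqP => _; rewrite ?mulr_gt0 ?powR_gt0// addr_gt0 ?mulr_gt0 ?powR_gt0.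
Qed.
End means.

(** * Measures with a density *)

Section density.
Local Open Scope ereal_scope.
Context d (T : measurableType d) (R : realType).
Variable mu : {measure set T -> \bar R}.
Variable k : T -> R.

(** The two proofs are arguments so that the measure structure on this function
    can be found from the term alone. *)
Definition density of measurable_fun setT k & (forall x, 0 <= k x)%R :=
  fun A : set T => \int[mu]_(x in A) (k x)%:E.

Hypotheses (mk : measurable_fun setT k) (k0 : forall x, (0 <= k x)%R).
Local Notation nu := (density mk k0).

Let mkE : measurable_fun setT (EFin \o k : T -> \bar R).
Proof. exact/measurable_EFinP. Qed.

Let density0 : nu set0 = 0.
Proof. by rewrite /density integral_set0. Qed.

Let density_ge0 A : 0 <= nu A.
Proof. by apply: integral_ge0 => x _; rewrite lee_fin. Qed.

Let density_sigma_additive : semi_sigma_additive nu.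
Proof.
move=> F mF tF mUF; apply: cvg_toP.
  apply: ereal_nondecreasing_is_cvgn => m n mn.
  by apply: lee_sum_nneg_natr => // i _ _; exact: density_ge0.
rewrite /density ge0_integral_bigcup//; first exact: measurable_funTS.
by move=> x _; rewrite lee_fin.
Qed.

HB.instance Definition _ := isMeasure.Build _ _ _ nu
  density0 density_ge0 density_sigma_additive.

Import HBNNSimple.

Lemma ge0_integral_density (f : T -> \bar R) : measurable_fun setT f ->
  (forall x, 0 <= f x) ->
  \int[nu]_x f x = \int[mu]_x (f x * (k x)%:E).
Proof.
move=> mf f0.
pose g := nnsfun_approx measurableT mf.
have ndg x : nondecreasing_seq (fun n => g n x).
  by move=> m n mn; exact/lefP/nd_nnsfun_approx.
have gf x : (g n x)%:E @[n --> \oo] --> f x.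
  by apply: (@cvg_nnsfun_approx _ _ _ _ measurableT f mf) => // y _; exact: f0.
have mg n : measurable_fun setT (EFin \o g n) by exact/measurable_EFinP.
transitivity (limn (fun n => \int[nu]_x (g n x)%:E)).
  rewrite -monotone_convergence//.
  - by apply: eq_integral => x _; apply/esym/cvg_lim.
  - by move=> n x _; rewrite lee_fin.
  - by move=> x _ m n mn; rewrite lee_fin ndg.
transitivity (limn (fun n => \int[mu]_x ((g n x)%:E * (k x)%:E))); last first.
  rewrite -monotone_convergence//.
  - apply: eq_integral => x _; apply/cvg_lim => //.
    exact: (@cvgeZr _ _ _ (fun n => (g n x)%:E) (f x) (k x)%:E _ (gf x)).
  - by move=> n; apply: emeasurable_funM; [exact: mg|exact: mkE].
  - by move=> n x _; rewrite mule_ge0 ?lee_fin.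
  - by move=> x _ m n mn; rewrite lee_wpmul2r ?lee_fin// ndg.
congr (limn _); apply/funext => n.
rewrite integralT_nnsfun sintegralE.
have mi r : measurable (g n @^-1` [set r]) by exact: measurable_funPTI.
transitivity (\int[mu]_x \sum_(r \in range (g n))
    (r * \1_(g n @^-1` [set r]) x)%:E * (k x)%:E); last first.
  apply: eq_integral => x _; rewrite -ge0_mule_fsuml.
    by rewrite fsumEFin// -fimfunE.
  by move=> r; exact: nnfun_muleindic_ge0.
rewrite ge0_integral_fsum//; last 2 first.
  - move=> r; apply: emeasurable_funM => //; apply/measurable_EFinP.
    exact: measurable_funM.
  - by move=> r x _; rewrite mule_ge0 ?lee_fin// -lee_fin nnfun_muleindic_ge0.
apply: eq_fsbigr => r; rewrite inE => -[y _ <-].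
under [RHS]eq_integral do rewrite EFinM -muleA.
rewrite ge0_integralZl//.
- congr (_ * _).
  transitivity (\int[mu]_(x in g n @^-1` [set g n y]) (k x)%:E); first by [].
  rewrite [LHS]integral_mkcond epatch_indic.
  by apply: eq_integral => x _ /=; rewrite muleC.
- by apply: emeasurable_funM => //; exact/measurable_EFinP.
- by move=> x _; rewrite mule_ge0 ?lee_fin.
- by rewrite lee_fin.
Qed.

End density.

(** * Increasing transports between masses on the line *)

Section quantile.
Context {R : realType} (P : probability (measurableTypeR R) R).
Local Notation mu := (@lebesgue_measure R).

Let idTR : measurableTypeR R -> R := idfun.
#[local] HB.instance Definition _ :=
  @isMeasurableFun.Build _ _ _ _ idTR (@measurable_id _ _ setT).
Let F r := fine (P `]-oo, r]%classic).

Let FE r : (F r)%:E = P `]-oo, r]%classic.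
Proof. by rewrite /F fineK// fin_num_measure. Qed.

Let F_nd : {homo F : x y / x <= y}.
Proof.
move=> x y xy; rewrite -lee_fin !FE; apply: le_measure; rewrite ?inE//.
by apply: subset_itvl; rewrite bnd_simp.
Qed.

(* Right continuity of the distribution function: the infimum that defines a
   quantile is attained. *)
Let F_rc (s x : R) : (forall y, x < y -> s <= F y) -> s <= F x.
Proof.
move=> H; rewrite -lee_fin FE.
have Fn : P `]-oo, (x + n.+1%:R^-1)]%classic @[n --> \oo] --> P `]-oo, x]%classic.
  rewrite (@itvNycEbigcap _ false).
  apply: nonincreasing_cvg_mu => [| | |m n mn].
  - by rewrite -ge0_fin_numE// fin_num_measure.
  - by [].
  - exact: bigcap_measurable.
  - apply/subsetPset; apply: subset_itvl.
    by rewrite bnd_simp lerD2l lef_pV2 ?posrE// ler_nat.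
rewrite -(cvg_lim _ Fn)//; apply: lime_ge; first by apply/cvg_ex; eexists; exact: Fn.
by apply: nearW => n; rewrite -FE lee_fin; apply: H; rewrite ltrDl.
Qed.

Let F_ge (s : R) : s < 1 -> exists x, s <= F x.
Proof.
move=> s1; have /= F1 := @cvg_cdfy1 _ _ _ P idTR.
have : \forall x \near +oo, (s%:E < cdf (idTR : {RV P >-> R}) x)%E.
  apply: (F1 [set y | (s%:E < y)%E]); apply: open_nbhs_nbhs; split => //.
  exact: open_ereal_gt_ereal.
case=> M [_ H]; exists (M + 1); rewrite -lee_fin FE.
by apply/ltW/H; rewrite ltrDl.
Qed.

Let F_le (s : R) : 0 < s -> exists x, F x < s.
Proof.
move=> s0; have /= F0 := @cvg_cdfNy0 _ _ _ P idTR.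
have : \forall x \near -oo, (cdf (idTR : {RV P >-> R}) x < s%:E)%E.
  apply: (F0 [set y | (y < s%:E)%E]); apply: open_nbhs_nbhs; split => //.
  exact: open_ereal_lt_ereal.
case=> M [_ H]; exists (M - 1); rewrite -lte_fin FE.
by apply/H; rewrite ltrBlDr ltrDl.
Qed.

Definition quantile (s : R) : R :=
  if 0 < s < 1 then inf [set x | s <= F x] else 0.

Lemma quantile_le s x : 0 < s < 1 -> (quantile s <= x) = (s%:E <= P `]-oo, x]%classic)%E.
Proof.
move=> /[dup] s01 /andP[s0 s1]; rewrite /quantile s01 -FE lee_fin.
have [y Fy] := F_le s0.
have lb : has_lbound [set x | s <= F x].
  exists y => z /= sz; rewrite leNgt; apply/negP => zy.
  by have := le_lt_trans (le_trans sz (F_nd (ltW zy))) Fy; rewrite ltxx.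
have hi : has_inf [set x | s <= F x] by split => //; have [z sz] := F_ge s1; exists z.
apply/idP/idP => [|sx]; last exact: ge_inf.
move=> ix; apply: le_trans (F_nd ix); apply: F_rc => z iz.
have [w /= sw wz] := inf_lt hi.1 iz.
by apply: le_trans sw (F_nd (ltW wz)).
Qed.

Lemma measurable_quantile : measurable_fun setT quantile.
Proof.
apply: (measurability (@RGenOInfty.G R)) => [|/= _ [_] [r] -> <-].
  exact: RGenOInfty.measurableE.
rewrite setTI.
have -> : quantile @^-1` `]r, +oo[%classic =
    (`]0, 1[%classic `&` `]F r, +oo[%classic) `|`
    (~` `]0, 1[%classic `&` (if r < 0 then setT else set0)).
  apply/seteqP; split => x /=; rewrite !in_itv/= !andbT.
    case: (boolP (0 < x < 1)) => x01; last first.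
      rewrite /quantile (negbTE x01) => r0; right; rewrite r0.
      by split => //; exact/negP.
    by rewrite ltNge quantile_le// -FE lee_fin -ltNge; left.
  case=> [[x01]|[/negP x01]].
    by rewrite ltNge => h; rewrite ltNge quantile_le// -FE lee_fin.
  by rewrite /quantile (negbTE x01); case: ifP.
apply: measurableU; first exact: measurableI.
by apply: measurableI; [exact: measurableC|case: ifP].
Qed.

(** The quantile function transports the uniform law on ]0, 1[ to P, because
    both measures give the same mass to every half-line. *)
Lemma quantile_pushforward E : measurable E ->
  mu (quantile @^-1` E `&` `]0, 1[%classic) = P E.
Proof.
pose T := measurableTypeR R.
have m01 : measurable (`]0, 1[%classic : set T) by exact: measurable_itv.
have mqT : @measurable_fun _ _ T T setT quantile by exact: measurable_quantile.
move=> mE; pose nu : {measure set T -> \bar R} :=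
  measure_function_pushforward__canonical__measure_function_Measure
    (mrestr mu m01) mqT.
have nuE A : nu A = mu (quantile @^-1` A `&` `]0, 1[%classic) by [].
rewrite -nuE; move: E mE.
apply: (@measure_unique _ R T (@RGenOInfty.G R)
  (fun k => `](- k%:R)%R, +oo[%classic) _ _ _ _ nu P) => //.
- exact: RGenOInfty.measurableE.
- move=> _ _ [x ->] [y ->]; exists (Num.max x y).
  by apply/seteqP; split => z /=; rewrite !in_itv/= !andbT gt_max => /andP.
- by move=> k; eexists.
- apply/seteqP; split => // x _; exists (Num.bound `|x|) => //=.
  by rewrite in_itv/= andbT ltrNl (le_lt_trans (ler_norm _))// normrN archi_boundP.
- move=> _ [x ->]; rewrite nuE.
  have -> : quantile @^-1` `]x, +oo[%classic `&` `]0, 1[%classic = `]F x, 1[%classic.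
    have F0 : 0 <= F x by rewrite -lee_fin FE.
    apply/seteqP; split => s /=; rewrite !in_itv/= !andbT.
      move=> [+ s01]; rewrite ltNge quantile_le// -FE lee_fin -ltNge => ->.
      by case/andP: s01.
    move=> /andP[Fs s1]; have s01 : 0 < s < 1 by rewrite (le_lt_trans F0).
    by split => //; rewrite ltNge quantile_le// -FE lee_fin -ltNge.
  have -> : `]x, +oo[%classic = ~` `]-oo, x]%classic by rewrite setCitvl.
  transitivity (1 - P `]-oo, x]%classic)%E; last by apply/esym/probability_setC.
  rewrite -FE lebesgue_measure_itv/= lte_fin.
  case: ltP => // F1; have /eqP -> : F x == 1; last by rewrite subee.
  by rewrite eq_le F1 -lee_fin FE probability_le1.
- move=> k; rewrite nuE; apply: (@le_lt_trans _ _ (mu `]0, 1[%classic)).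
    apply: le_measure; rewrite ?inE//.
    by apply: measurableI => //; rewrite -[X in measurable X]setTI; exact: measurable_quantile.
  by rewrite lebesgue_measure_itv/= lte_fin ltr01 ltry.
Qed.
End quantile.

(** * Substitution along an expanding map *)

Section expansion.
Context {R : realType}.
Local Notation mu := (@lebesgue_measure R).
Variables z k : R -> R.
Hypotheses (mz : measurable_fun setT z) (mk : measurable_fun setT k).
Hypothesis k0 : forall x, 0 <= k x.
Hypothesis zk : forall s s', 0 < s -> s < s' -> s' < 1 ->
  (\int[mu]_(x in `]s, s'[) (k x)%:E <= (z s' - z s)%:E)%E.

Let kE : measurable_fun setT (EFin \o k : R -> \bar R).
Proof. exact/measurable_EFinP. Qed.

Let znd s s' : 0 < s -> s < s' -> s' < 1 -> z s <= z s'.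
Proof.
move=> s0 ss s1; rewrite -subr_ge0 -lee_fin; apply: le_trans (zk s0 ss s1).
by apply: integral_ge0 => x _; rewrite lee_fin.
Qed.

Let znd' s s' : 0 < s -> s <= s' -> s' < 1 -> z s <= z s'.
Proof. by move=> s0; rewrite le_eqVlt => /predU1P[->//|]; exact: znd. Qed.

(** The preimage of an interval is an interval up to its end points, and it is
    exhausted from inside by open intervals whose end points satisfy the
    expansion hypothesis. *)
Lemma expansion_itv (a b : R) : a <= b ->
  (\int[mu]_(x in `]0%R, 1%R[ `&` z @^-1` `]a, b]) (k x)%:E <= (b - a)%:E)%E.
Proof.
move=> ab; set I := `]0, 1[%classic `&` _.
have ba0 : (0 <= (b - a)%:E)%E by rewrite lee_fin subr_ge0.
have [->|/set0P[x0 Ix0]] := eqVneq I set0; first by rewrite integral_set0.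
have I0 : I !=set0 by exists x0.
have hl : has_lbound I by exists 0 => x [/=]; rewrite in_itv/= => /andP[/ltW].
have hu : has_ubound I by exists 1 => x [/=]; rewrite in_itv/= => /andP[_ /ltW].
pose i0 := inf I; pose i1 := sup I.
have inI s s' : i0 < s -> s < s' -> s' < i1 ->
    [/\ 0 < s, s' < 1 & z s' - z s <= b - a].
  move=> /(inf_lt I0)[u [/=]]; rewrite !in_itv/= => /andP[u0 u1] /andP[au ub] us ss.
  move=> /(sup_gt I0)[v [/=]]; rewrite !in_itv/= => /andP[v0 v1] /andP[av vb] sv.
  have s0 := lt_trans u0 us; have s1 := lt_trans sv v1.
  split => //; apply: lerB.
    by apply: le_trans vb; apply: znd' => //; [exact: lt_trans ss|exact: ltW].
  by apply: le_trans (ltW au) _; apply: znd' => //; [exact: ltW|exact: lt_trans s1].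
have mI : measurable I.
  by apply: measurableI => //; rewrite -[X in measurable X]setTI; exact: mz.
have II : I `<=` `[i0, i1]%classic.
  by move=> x Ix; rewrite /= in_itv/= (ge_inf hl Ix) (ub_le_sup hu Ix).
apply: (@le_trans _ _ (\int[mu]_(x in `[i0, i1]) (k x)%:E)%E).
  apply: ge0_subset_integral => //; first exact: measurable_funTS.
  by move=> x _; rewrite lee_fin.
rewrite integral_itv_bndoo; last exact: measurable_funTS.
pose F (n : nat) : set R := `]i0 + n.+1%:R^-1, i1 - n.+1%:R^-1[%classic.
pose rho := density mu mk k0.
have Fcvg : rho (F n) @[n --> \oo] --> rho (\bigcup_n F n).
  have mF n : measurable (F n) by exact: measurable_itv.
  apply: nondecreasing_cvg_mu => //; first by apply: bigcupT_measurable.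
  move=> m n mn; apply/subsetPset; apply: subset_itv; rewrite bnd_simp.
    by rewrite lerD2l lef_pV2 ?posrE// ler_nat.
  by rewrite lerD2l lerN2 lef_pV2 ?posrE// ler_nat.
have -> : (\int[mu]_(x in `]i0, i1[) (k x)%:E = rho (\bigcup_n F n))%E.
  congr (integral _ _ _); apply/seteqP; split => x /=.
    rewrite in_itv/= => /andP[x0' x1'].
    have e0 : 0 < Num.min (x - i0) (i1 - x) by rewrite lt_min !subr_gt0 x0'.
    have [n _ Hn] := near_infty_natSinv_lt (PosNum e0).
    exists n => //=; have /= := Hn n (leqnn n).
    rewrite lt_min => /andP[h1 h2]; rewrite /F /= in_itv /=.
    by rewrite -ltrBrDl h1 ltrBrDl -ltrBrDr h2.
  move=> [n _]; rewrite /F /= !in_itv/= => /andP[h1 h2].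
  have n0 : 0 < n.+1%:R^-1 :> R by [].
  by rewrite (lt_trans _ h1) ?ltrDl// (lt_trans h2)// ltrBlDr ltrDl.
rewrite -(cvg_lim _ Fcvg)//; apply: lime_le; first by apply/cvg_ex; eexists; exact: Fcvg.
apply: nearW => n.
have [ss|ss] := ltP (i0 + n.+1%:R^-1) (i1 - n.+1%:R^-1); last first.
  by rewrite /F set_itv_ge ?bnd_simp -?leNgt// /rho /density integral_set0.
have [||s0 s1 zz] := inI _ _ _ ss _; first by rewrite ltrDl.
  by rewrite ltrBlDr ltrDl.
by apply: le_trans (zk s0 ss s1) _; rewrite lee_fin.
Qed.

(** If z increases at least as fast as a primitive of k, then the image under z
    of the measure with density k is below the Lebesgue measure: this holds on
    intervals, hence on all Borel sets by covering them with intervals. No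
    differentiability of z is needed. *)
Lemma expansive_substitution (h : R -> \bar R) : measurable_fun setT h ->
  (forall x, 0 <= h x)%E ->
  (\int[mu]_(x in `]0%R, 1%R[) (h (z x) * (k x)%:E) <= \int[mu]_x h x)%E.
Proof.
move=> mh h0.
have m01 : measurable (`]0, 1[%classic : set R) by exact: measurable_itv.
pose k1 := k \_ `]0, 1[%classic.
have mk1 : measurable_fun setT k1.
  by apply/(measurable_restrictT _ m01); apply: measurable_funTS.
have k10 x : 0 <= k1 x by rewrite /k1 patchE; case: ifP.
(* All measures are typed on the carrier of the Lebesgue measure, so that they
   can be compared with it. *)
pose T := measurableTypeR R.
have mkT : @measurable_fun _ _ T _ setT k1 by exact: mk1.
have mzT : @measurable_fun _ _ T T setT z by exact: mz.
have mhT : @measurable_fun _ _ T _ setT h by exact: mh.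
have mhzT : @measurable_fun _ _ T _ setT (h \o z).
  exact: (measurableT_comp mh mz).
pose nu : {measure set T -> \bar R} :=
  measure_function_pushforward__canonical__measure_function_Measure
    (density mu mkT k10) mzT.
have nuE (E : set R) : measurable E ->
    nu E = (\int[mu]_(x in `]0%R, 1%R[ `&` z @^-1` E) (k x)%:E)%E.
  move=> mE; rewrite setIC integral_mkcondr.
  by apply: eq_integral => x _; rewrite /k1 !patchE; case: ifP.
have numu (E : set R) : measurable E -> (nu E <= mu E)%E.
  move=> mE; rewrite /lebesgue_measure/= /lebesgue_stieltjes_measure /measure_extension.
  apply: le_ereal_inf_tmp => _ [F [mF EF] <-].
  have mF' n : measurable (F n : set R) by apply: sub_sigma_algebra; exact: mF.
  apply: (@le_trans _ _ (\sum_(n <oo) nu (F n))%E).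
    exact: measure_sigma_subadditive.
  apply: lee_nneseries => [n _ _ //|n _].
  rewrite nuE//; have := mF n; rewrite /measurable/= => -[[a b] _ <-] /=.
  have [ab|ba] := leP a b.
    by rewrite wlength_itv_bnd//; exact: expansion_itv.
  have -> : `]a, b]%classic = set0 :> set R.
    by rewrite set_itv_ge// bnd_simp -leNgt ltW.
  by rewrite preimage_set0 setI0 integral_set0 wlength0.
have := @ge0_le_measure_integral _ T R nu mu numu h setT measurableT h0 mhT.
apply: le_trans.
rewrite (ge0_integral_pushforward mzT)// (ge0_integral_density mu mkT k10 mhzT)//.
  rewrite le_eqVlt; apply/orP; left; apply/eqP; rewrite [LHS]integral_mkcond.
  apply: eq_integral => x _; rewrite patchE /k1 patchE /=.
  by case: ifP => // _; rewrite mule0.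
by move=> x; exact: h0.
Qed.
End expansion.

(** * The inequality on the line *)

Lemma measurable_inv_ge0 (R : realType) (u : R -> R) : measurable_fun setT u ->
  (forall x, 0 <= u x) -> measurable_fun setT (fun x => (u x)^-1).
Proof.
move=> mu u0; rewrite (_ : (fun _ => _) = (@powR R ^~ (-1)) \o u); last first.
  by apply/funext => x /=; rewrite powR_inv1.
by apply: measurableT_comp => //; exact: measurable_powR.
Qed.

Section transport.
Context {R : realType}.
Local Notation mu := (@lebesgue_measure R).
Variables (f : R -> R) (a : R).
Hypotheses (mf : measurable_fun setT f) (f0 : forall x, 0 <= f x).
Hypotheses (a0 : 0 < a) (fa : (\int[mu]_x (f x)%:E)%E = a%:E).

(** A mass distribution f of total mass a on the line is the image of the
    uniform law on ]0, 1[ under its quantile function X. *)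
Lemma mass_transport_exists : exists X : R -> R,
  [/\ measurable_fun setT X,
     forall s s', 0 < s -> s <= s' -> s' < 1 -> X s <= X s' &
     forall G : R -> \bar R, measurable_fun setT G -> (forall x, 0 <= G x)%E ->
       (\int[mu]_(s in `]0%R, 1%R[) G (X s) =
        \int[mu]_x (G x * (f x / a)%:E))%E].
Proof.
pose T := measurableTypeR R.
pose k x := f x / a.
have k0 x : 0 <= k x by rewrite divr_ge0// ltW.
have mk : @measurable_fun _ _ T _ setT k by exact: measurable_funM.
have PT : density mu mk k0 setT = 1%E.
  rewrite /density; under eq_integral do rewrite /k mulrC EFinM.
  rewrite ge0_integralZl//=; last 3 first.
  - exact/measurable_EFinP.
  - by move=> x _; rewrite lee_fin.
  - by rewrite lee_fin invr_ge0 ltW.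
  by rewrite fa -EFinM mulVf// gt_eqF.
pose PM : {measure set T -> \bar R} := density mu mk k0.
pose P : probability T R := HB.pack (PM : set T -> \bar R) (Measure.class PM)
   (Measure_isProbability.Build _ _ _ PM PT).
have PE (E : set T) : P E = (\int[mu]_(x in E) (k x)%:E)%E by [].
clearbody P.
pose X := quantile P; pose i01 : R -> R := \1_(`]0, 1[%classic : set R).
have m01 : measurable (`]0, 1[%classic : set T) by exact: measurable_itv.
have mXT : @measurable_fun _ _ T T setT X by exact: measurable_quantile.
have miT : @measurable_fun _ _ T _ setT i01 by exact: measurable_indic.
have i010 x : 0 <= i01 x by rewrite /i01 indicE.
pose nu : {measure set T -> \bar R} :=
  measure_function_pushforward__canonical__measure_function_Measure
    (density mu miT i010) mXT.
have nuP (E : set T) : measurable E -> nu E = P E.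
  move=> mE; rewrite -quantile_pushforward//.
  transitivity (\int[mu]_(x in X @^-1` E) (i01 x)%:E)%E; first by [].
  rewrite integral_indic// 1?setIC//.
  by rewrite -[_ @^-1` _]setTI; apply: (measurable_quantile P).
exists X; split; first exact: measurable_quantile.
  move=> s s' s0 ss s1; have s01 : 0 < s < 1 by rewrite s0 (le_lt_trans ss).
  have s'01 : 0 < s' < 1 by rewrite s1 (lt_le_trans s0).
  rewrite quantile_le//; apply: (@le_trans _ _ s'%:E); first by rewrite lee_fin.
  by rewrite -quantile_le.
move=> G mG G0.
have mGT : @measurable_fun _ _ T _ setT G by exact: mG.
have mGX : @measurable_fun _ _ T _ setT (G \o X).
  exact: (measurableT_comp mG (measurable_quantile P)).
transitivity (\int[nu]_x G x)%E.
  rewrite (ge0_integral_pushforward mXT)// (ge0_integral_density mu miT i010 mGX).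
    rewrite [LHS]integral_mkcond; apply: eq_integral => x _.
    by rewrite epatch_indic /=.
  by move=> x; exact: G0.
transitivity (\int[density mu mk k0]_x G x)%E; last first.
  by rewrite (ge0_integral_density mu mk k0 mGT).
apply: eq_measure_integral => E mE _; rewrite nuP// PE.
Qed.

Hypothesis fN : forall x, x < 0 -> f x = 0.

(** The fourth property is the inequality version of X' = a / f (X): the image
    of a / f (X) under X is the Lebesgue measure restricted to the points where f
    is positive. Strict monotonicity holds because f dx has no atom. *)
Lemma mass_transport : exists X : R -> R,
  [/\ measurable_fun setT X,
     forall s, 0 < s < 1 -> 0 < X s,
     forall s s', 0 < s -> s < s' -> s' < 1 -> X s < X s',
     forall s s', 0 < s -> s < s' -> s' < 1 ->
       (\int[mu]_(r in `]s, s'[) (a / f (X r))%:E <= (X s' - X s)%:E)%E &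
     {ae mu, forall s, `]0, 1[%classic s -> 0 < f (X s)}].
Proof.
have [X [mX ndX XE]] := mass_transport_exists.
have mI (A : set R) : measurable A -> measurable_fun setT (fun x : R => (\1_A x : R)%:E).
  by move=> mA; apply/measurable_EFinP; exact: measurable_indic.
have mXA (A : set R) : measurable A -> measurable (X @^-1` A).
  by move=> mA; rewrite -[_ @^-1` _]setTI; exact: mX.
have m01 : measurable (`]0, 1[%classic : set R) by exact: measurable_itv.
have X0E (A : set R) : measurable A ->
    (mu (`]0%R, 1%R[%classic `&` X @^-1` A) =
     \int[mu]_x ((\1_A x : R)%:E * (f x / a)%:E))%E.
  move=> mA; rewrite -(XE _ (mI _ mA)); last by move=> x; rewrite lee_fin indicE.
  by rewrite setIC -(integral_indic mu m01 (mXA _ mA)).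
have mfa : measurable_fun setT (fun x => (f x / a)%:E).
  by apply/measurable_EFinP; exact: measurable_funM.
have fa0 x : (0 <= (f x / a)%:E)%E by rewrite lee_fin divr_ge0// ltW.
have Xnull (A : set R) : measurable A ->
    (\int[mu]_(x in A) (f x / a)%:E = 0)%E ->
    (mu (`]0%R, 1%R[%classic `&` X @^-1` A) = 0)%E.
  move=> mA A0; rewrite X0E//; rewrite -A0 [RHS]integral_mkcond epatch_indic.
  by apply: eq_integral => x _ /=; rewrite muleC.
have Xitv s s' (A : set R) : measurable A -> 0 <= s -> s < s' -> s' <= 1 ->
    (\int[mu]_(x in A) (f x / a)%:E = 0)%E -> `]s, s'[%classic `<=` X @^-1` A -> False.
  move=> mA s0 ss s1 A0 sub; have := Xnull _ mA A0; apply/eqP; rewrite gt_eqF//.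
  have : (0 < mu `]s, s'[%classic)%E by rewrite lebesgue_measure_itv/= lte_fin ss lte_fin subr_gt0.
  move=> /lt_le_trans; apply; apply: le_measure; rewrite ?inE//.
    by apply: measurableI => //; exact: mXA.
  move=> x xs; split; last exact: sub.
  move: xs; rewrite /= !in_itv/= => /andP[sx xs].
  by rewrite (le_lt_trans s0)// (lt_le_trans xs).
have Xgt0 s : 0 < s < 1 -> 0 < X s.
  move=> /andP[s0 s1]; rewrite ltNge; apply/negP => Xs.
  apply: (@Xitv 0 s `]-oo, 0]%classic) => //; first exact: ltW.
    rewrite -integral_itv_bndo_bndc; last exact: measurable_funTS.
    by rewrite integral0_eq// => x /=; rewrite in_itv/= => /fN ->; rewrite mul0r.
  move=> x /=; rewrite !in_itv/= => /andP[x0 xs].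
  by apply: le_trans Xs; apply: ndX => //; exact: ltW.
have Xlt s s' : 0 < s -> s < s' -> s' < 1 -> X s < X s'.
  move=> s0 ss s1; rewrite lt_neqAle ndX ?(ltW ss)// andbT; apply/eqP => XX.
  apply: (@Xitv s s' [set X s]) => //; [exact: ltW|exact: ltW| |].
    by rewrite integral_set1.
  move=> x /=; rewrite in_itv/= => /andP[sx xs]; apply/le_anti/andP; split.
    by rewrite XX; apply: ndX => //; [exact: lt_trans sx|exact: ltW].
  by apply: ndX => //; [exact: ltW|exact: lt_trans s1].
have mfV := measurable_inv_ge0 mf f0.
exists X; split => //.
  move=> s s' s0 ss s1.
  pose G x := ((a / f x) * \1_(`[X s, X s']%classic : set R) x)%:E.
  have mG : measurable_fun setT G.
    apply/measurable_EFinP; apply: measurable_funM; last exact: measurable_indic.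
    by apply: measurable_funM => //; exact: mfV.
  have G0 x : (0 <= G x)%E.
    by rewrite lee_fin mulr_ge0 ?indicE// divr_ge0// ltW.
  apply: (@le_trans _ _ (\int[mu]_(r in `]0%R, 1%R[) G (X r))%E).
    apply: (@le_trans _ _ (\int[mu]_(r in `]s, s'[) G (X r))%E).
      rewrite le_eqVlt; apply/orP; left; apply/eqP; apply: eq_integral => r.
      rewrite inE/= in_itv/= => /andP[sr rs]; rewrite /G indicE mem_set ?mulr1//=.
      rewrite in_itv/= !ndX ?(ltW sr) ?(ltW rs)//; [exact: lt_trans sr|exact: lt_trans s1].
    have mGX : measurable_fun setT (G \o X) by exact: measurableT_comp.
    apply: ge0_subset_integral => //; first exact: measurable_funTS.
    move=> r /=; rewrite !in_itv/= => /andP[sr rs].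
    by rewrite (lt_trans s0)// (lt_trans rs).
  rewrite XE//.
  have XX := Xlt _ _ s0 ss s1.
  apply: (@le_trans _ _ (\int[mu]_x (\1_(`[X s, X s']%classic : set R) x : R)%:E)%E).
    apply: ge0_le_integral => //.
    - by move=> x _; rewrite mule_ge0.
    - exact: emeasurable_funM.
    - exact: mI.
    move=> x _; rewrite /G -EFinM lee_fin; have [->|fx] := eqVneq (f x) 0.
      by rewrite mul0r mulr0 indicE.
    rewrite mulrAC (_ : a / f x * (f x / a) = 1) ?mul1r//.
    by rewrite mulrA divfK// divff// gt_eqF.
  have mXX : measurable (`[X s, X s']%classic : set R) by exact: measurable_itv.
  rewrite (integral_indic mu measurableT mXX) setIT.
  have := lebesgue_measure_itv `[X s, X s'].
  by rewrite /= lte_fin XX -EFinB => <-.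
exists (`]0, 1[%classic `&` X @^-1` (f @^-1` [set 0])); split.
- apply: measurableI => //; apply: mXA; rewrite -[_ @^-1` _]setTI; exact: mf.
- apply: Xnull; first by rewrite -[_ @^-1` _]setTI; exact: mf.
  by rewrite integral0_eq// => x /= ->; rewrite mul0r.
- move=> s /=; rewrite not_implyE => -[s01 fs]; split => //=.
  by apply/eqP; rewrite eq_le f0 andbT leNgt; apply/negP.
Qed.
End transport.

Section line.
Context {R : realType}.
Local Notation mu := (@lebesgue_measure R).

Lemma measurable_wmean d (T : measurableType d) (c e s : R) (u v : T -> R) :
  measurable_fun setT u -> measurable_fun setT v ->
  measurable_fun setT (fun x => wmean c e s (u x) (v x)).
Proof.
move=> mu' mv; apply: (measurableT_comp (measurable_powR s)).
apply: measurable_funD; apply: measurable_funM => //.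
  exact: (measurableT_comp (measurable_powR _)).
exact: (measurableT_comp (measurable_powR _)).
Qed.

(** Transport both f and g to the same interval ]0, 1[ by X and Y, and follow the
    mean z of X and Y. By superadditivity the increment of z is at least the mean
    of the increments of X and Y, which by concavity is at least the integral of
    k = wmean (a / f (X)) (b / g (Y)); so the integral of h is at least that of
    h (z) k over ]0, 1[, whose integrand is at least K almost everywhere. *)
Lemma curvilinear_line (c d s a b K : R) (f g : R -> R) (h : R -> \bar R) :
  0 < c -> 0 < d -> 1 <= s -> 0 < a -> 0 < b -> 0 <= K ->
  measurable_fun setT f -> measurable_fun setT g -> measurable_fun setT h ->
  (forall x, 0 <= f x) -> (forall x, 0 <= g x) -> (forall x, 0 <= h x)%E ->
  (forall x, x < 0 -> f x = 0) -> (forall x, x < 0 -> g x = 0) ->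
  (\int[mu]_x (f x)%:E = a%:E)%E -> (\int[mu]_x (g x)%:E = b%:E)%E ->
  (forall x y, 0 < x -> 0 < y -> 0 < f x -> 0 < g y ->
    (K%:E <= h (wmean c d s x y) * (wmean c d s (a / f x) (b / g y))%:E)%E) ->
  (K%:E <= \int[mu]_x h x)%E.
Proof.
move=> c0 d0 s1 a0 b0 K0 mf mg mh f0 g0 h0 fN gN fa gb HK.
have [X [mX X0 Xlt Xle Xae]] := mass_transport mf f0 a0 fa fN.
have [Y [mY Y0 Ylt Yle Yae]] := mass_transport mg g0 b0 gb gN.
pose z r := wmean c d s (X r) (Y r).
have mz : measurable_fun setT z by exact: measurable_wmean.
have mV (w : R) (u : R -> R) : measurable_fun setT u -> (forall x, 0 <= u x) ->
    measurable_fun setT (fun x => w / u x).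
  by move=> mu' u0; apply: measurable_funM => //; exact: measurable_inv_ge0.
pose k r := wmean c d s (a / f (X r)) (b / g (Y r)).
have mfX : measurable_fun setT (fun r => a / f (X r)).
  by apply: mV => //; exact: measurableT_comp.
have mgY : measurable_fun setT (fun r => b / g (Y r)).
  by apply: mV => //; exact: measurableT_comp.
have mk : measurable_fun setT k by exact: measurable_wmean.
have k0 r : 0 <= k r by exact: powR_ge0.
have aX0 r : 0 <= a / f (X r) by rewrite divr_ge0// ltW.
have bY0 r : 0 <= b / g (Y r) by rewrite divr_ge0// ltW.
have m01 : measurable (`]0, 1[%classic : set R) by exact: measurable_itv.
have zk r r' : 0 < r -> r < r' -> r' < 1 ->
    (\int[mu]_(x in `]r, r'[) (k x)%:E <= (z r' - z r)%:E)%E.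
  move=> r0 rr r1.
  have DX : 0 < X r' - X r by rewrite subr_gt0 Xlt.
  have DY : 0 < Y r' - Y r by rewrite subr_gt0 Ylt.
  have r01 : 0 < r < 1 by rewrite r0 (lt_trans rr).
  have Dz : wmean c d s (X r' - X r) (Y r' - Y r) <= z r' - z r.
    rewrite lerBrDr addrC.
    have := wmean_superadditive c0 d0 s1 (X0 _ r01) (Y0 _ r01) DX DY.
    by rewrite !subrKC.
  have [w1 [w2 [w10 w20 wE Hw]]] := wmean_tangent c0 d0 s1 DX DY.
  apply: (@le_trans _ _ (\int[mu]_(x in `]r, r'[)
      (w1%:E * (a / f (X x))%:E + w2%:E * (b / g (Y x))%:E))%E).
    apply: ge0_le_integral => //.
    - by move=> x _; rewrite lee_fin.
    - by apply/measurable_EFinP; exact: measurable_funTS.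
    - apply/measurable_funTS/emeasurable_funD; apply: emeasurable_funM => //;
      exact/measurable_EFinP.
    - by move=> x _; rewrite -!EFinM -EFinD lee_fin Hw.
  rewrite ge0_integralD//; last 4 first.
  - by move=> x _; rewrite -EFinM lee_fin mulr_ge0.
  - apply/measurable_funTS/emeasurable_funM => //; exact/measurable_EFinP.
  - by move=> x _; rewrite -EFinM lee_fin mulr_ge0.
  - apply/measurable_funTS/emeasurable_funM => //; exact/measurable_EFinP.
  rewrite !ge0_integralZl//; last 4 first.
  - exact/measurable_funTS/measurable_EFinP.
  - by move=> x _; rewrite lee_fin.
  - exact/measurable_funTS/measurable_EFinP.
  - by move=> x _; rewrite lee_fin.
  apply: (@le_trans _ _ (w1%:E * (X r' - X r)%:E + w2%:E * (Y r' - Y r)%:E)%E).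
    by apply: leeD; apply: lee_wpmul2l; rewrite ?lee_fin ?Xle ?Yle.
  by rewrite -!EFinM -EFinD lee_fin -wE.
apply: le_trans (expansive_substitution mz mk k0 zk mh h0).
have -> : K%:E = (\int[mu]_(x in `]0%R, 1%R[) K%:E)%E.
  rewrite integral_cst//= lebesgue_measure_itv/= lte_fin ltr01.
  by rewrite -EFinB subr0 mule1.
apply: ae_ge0_le_integral => //.
- by move=> x _; rewrite mule_ge0// lee_fin.
- apply/measurable_funTS/emeasurable_funM; last exact/measurable_EFinP.
  exact: (measurableT_comp mh mz).
apply: (@filterS2 _ _ (ae_filter_ringOfSetsType mu) _ _ _ _ Xae Yae) => r Xr Yr r01.
apply: HK; [exact: X0|exact: Y0|exact: Xr|exact: Yr].
Qed.
End line.

(** * Induction on the dimension by slicing off the first coordinate *)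

Section slices.
Context {R : realType}.
Local Notation mu := (@lebesgue_measure R).

Definition slice (m : nat) (A : set (m.+1.-tuple R)) (x : R) : set (m.-tuple R) :=
  [set y | A (cons_pair (x, y))].

Lemma slice_xsection m (A : set (m.+1.-tuple R)) x :
  slice A x = xsection (cons_pair (m := m) @^-1` A) x.
Proof. by apply/seteqP; split => y /=; rewrite /xsection /= inE. Qed.

Lemma measurable_cons_preimage m (A : set (m.+1.-tuple R)) :
  measurable A -> measurable (cons_pair (m := m) @^-1` A).
Proof.
by move=> mA; rewrite -[_ @^-1` _]setTI; exact: measurable_cons_pair.
Qed.

Lemma measurable_slice m (A : set (m.+1.-tuple R)) x :
  measurable A -> measurable (slice A x).
Proof.
move=> mA; rewrite slice_xsection; apply: measurable_xsection.
exact: measurable_cons_preimage.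
Qed.

Lemma measurable_slice_volume m (A : set (m.+1.-tuple R)) : measurable A ->
  measurable_fun setT (fun x : R => borel_volume R m (slice A x)).
Proof.
move=> mA; under eq_fun do rewrite slice_xsection.
exact: (measurable_fun_xsection (borel_volume R m) (measurable_cons_preimage mA)).
Qed.

Lemma borel_volume_slice m (A : set (m.+1.-tuple R)) :
  borel_volume R m.+1 A = (\int[mu]_x borel_volume R m (slice A x))%E.
Proof.
rewrite /= /cons_measure /pushforward /product_measure1.
by apply: eq_integral => x _ /=; rewrite slice_xsection.
Qed.

Lemma measurable_slice1 (A : set (1.-tuple R)) : measurable A ->
  measurable [set x : R | A (cons_pair (x, [tuple]))].
Proof.
move=> mA; rewrite -[X in measurable X]setTI.
have -> : [set x : R | A (cons_pair (x, [tuple]))] =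
  (fun x => cons_pair (x, [tuple])) @^-1` A by [].
by apply: (measurableT_comp (@measurable_cons_pair R 0)).
Qed.

Lemma borel_volume_slice1 (A : set (1.-tuple R)) : measurable A ->
  borel_volume R 1 A = mu [set x | A (cons_pair (x, [tuple]))].
Proof.
move=> mA; rewrite borel_volume_slice; have mA1 := measurable_slice1 mA.
rewrite -[[set _ | _]]setIT -[RHS](integral_indic mu measurableT mA1).
apply: eq_integral => x _ /=; rewrite diracE indicE.
by congr ((_%:R)%:E); apply: asbool_equiv_eq.
Qed.

Definition nonneg_tuples m (A : set (m.-tuple R)) :=
  forall x, A x -> forall i, 0 <= tnth x i.

(** What the induction uses of a set that equals its compression; unlike the
    latter property, it passes to the slices at once. *)
Definition last_downward_closed m (A : set (m.+1.-tuple R)) :=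
  forall x y, A x -> (forall i, i != ord_max -> tnth y i = tnth x i) ->
  0 <= tnth y ord_max <= tnth x ord_max -> A y.

Definition mean_exponent m (r : nat -> R) (e : \bar R) (i : nat) : \bar R :=
  if (i < m)%N then (r i)%:E else e.

Definition mean_tuple m (c d : R) (ex : nat -> \bar R) (x y : m.-tuple R) : m.-tuple R :=
  [tuple weighted_mean c d (ex i) (tnth x i) (tnth y i) | i < m].

(** Only points with positive coordinates are combined, because a mean with a
    zero argument is 0 by convention. *)
Definition absorbs_means m (c d : R) (ex : nat -> \bar R) (A B G : set (m.-tuple R)) :=
  forall x y, A x -> B y -> (forall i, 0 < tnth x i) -> (forall i, 0 < tnth y i) ->
  G (mean_tuple c d ex x y).

Lemma tnth_cons_pair0 m (x : R) (u : m.-tuple R) : tnth (cons_pair (x, u)) ord0 = x.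
Proof. by []. Qed.

Lemma tnth_cons_pairS m (x : R) (u : m.-tuple R) i :
  tnth (cons_pair (x, u)) (lift ord0 i) = tnth u i.
Proof. by rewrite /cons_pair tnthS. Qed.

Lemma nonneg_slice m (A : set (m.+1.-tuple R)) x :
  nonneg_tuples A -> nonneg_tuples (slice A x).
Proof. by move=> A0 u /A0 Au i; have := Au (lift ord0 i); rewrite tnth_cons_pairS. Qed.

Lemma bounded_slice m (A : set (m.+1.-tuple R)) x :
  bounded_tuples A -> bounded_tuples (slice A x).
Proof.
by move=> [M AM]; exists M => u /AM Au i; have := Au (lift ord0 i); rewrite tnth_cons_pairS.
Qed.

Lemma last_downward_closed_slice m (A : set (m.+2.-tuple R)) x :
  last_downward_closed A -> last_downward_closed (slice A x).
Proof.
move=> Ad u v Au uv vm; apply: Ad Au _ _.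
  move=> i; have [j ->|->//] := unliftP ord0 i; rewrite !tnth_cons_pairS => jm.
  by apply: uv; apply: contra_neq jm => ->; apply/val_inj.
have -> : ord_max = lift ord0 ord_max :> 'I_m.+2 by exact/val_inj.
by rewrite !tnth_cons_pairS.
Qed.

Lemma absorbs_means_slice m (c d : R) (ex : nat -> \bar R)
    (A B G : set (m.+1.-tuple R)) x y : 0 < x -> 0 < y ->
  absorbs_means c d ex A B G ->
  absorbs_means c d (fun i => ex i.+1) (slice A x) (slice B y)
    (slice G (weighted_mean c d (ex 0%N) x y)).
Proof.
move=> x0 y0 H u v Au Bv u0 v0; have := H _ _ Au Bv _ _.
have -> : mean_tuple c d ex (cons_pair (x, u)) (cons_pair (y, v)) =
    cons_pair (weighted_mean c d (ex 0%N) x y, mean_tuple c d (fun i => ex i.+1) u v).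
  apply/eq_from_tnth => i; rewrite tnth_mktuple.
  have [j ->|->//] := unliftP ord0 i.
  by rewrite !tnth_cons_pairS tnth_mktuple.
apply=> i; have [j ->|->//] := unliftP ord0 i; rewrite tnth_cons_pairS; [exact: u0|exact: v0].
Qed.

Lemma borel_volume_fineK m (A : set (m.-tuple R)) : measurable A -> bounded_tuples A ->
  (fine (borel_volume R m A))%:E = borel_volume R m A.
Proof. by move=> mA Ab; rewrite fineK// -volume_Borel// volume_bounded. Qed.

Lemma weighted_meanE (c d r x y : R) : 0 < r -> 0 < x -> 0 < y ->
  weighted_mean c d r%:E x y = wmean c d r^-1 x y.
Proof.
by move=> r0 x0 y0; rewrite /weighted_mean mulf_eq0 !gt_eqF//= /wmean invrK.
Qed.

Lemma fine_borel_volume_gt0 m (A : set (m.-tuple R)) :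
  measurable A -> bounded_tuples A -> (0 < borel_volume R m A)%E ->
  0 < fine (borel_volume R m A).
Proof. by move=> mA Ab; rewrite -lte_fin borel_volume_fineK. Qed.

(** Base case: on the last coordinate both sets are initial segments of the
    half-line, and by homogeneity the means of proportional points of them fill
    an interval starting at 0. *)
Lemma curvilinear_volume1 (c d : R) e (A B G : set (1.-tuple R)) :
  0 < c -> 0 < d -> (e = 0%E -> c + d = 1) ->
  measurable A -> measurable B -> measurable G ->
  nonneg_tuples A -> nonneg_tuples B -> bounded_tuples A -> bounded_tuples B ->
  last_downward_closed A -> last_downward_closed B ->
  (0 < borel_volume R 1 A)%E -> (0 < borel_volume R 1 B)%E ->
  absorbs_means c d (fun=> e) A B G ->
  ((weighted_mean c d e (fine (borel_volume R 1 A)) (fine (borel_volume R 1 B)))%:E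
    <= borel_volume R 1 G)%E.
Proof.
move=> c0 d0 ecd mA mB mG A0 B0 Ab Bb Ad Bd Apos Bpos H.
have initial (C : set (1.-tuple R)) : measurable C -> nonneg_tuples C ->
    bounded_tuples C -> last_downward_closed C -> (0 < borel_volume R 1 C)%E ->
    0 < fine (borel_volume R 1 C) /\
    forall s, 0 < s < fine (borel_volume R 1 C) -> C (cons_pair (s, [tuple])).
  move=> mC C0 Cb Cd; rewrite -(borel_volume_fineK mC Cb) lte_fin => Cp.
  split=> //= s /andP[s0 sv]; apply: contrapT => Cs.
  have : (borel_volume R 1 C <= s%:E)%E.
    rewrite borel_volume_slice1//.
    apply: (@le_trans _ _ (mu `[0, s]%classic)); last first.
      by rewrite lebesgue_measure_itv/= lte_fin s0 -EFinB subr0.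
    apply: le_measure; rewrite ?inE//; first exact: measurable_slice1.
    move=> x /= Cx; rewrite in_itv/=.
    have x0 := C0 _ Cx ord0; rewrite tnth_cons_pair0 in x0; rewrite x0/=.
    rewrite leNgt; apply/negP => sx; apply: Cs; apply: (Cd _ _ Cx) => [i|].
      by rewrite (ord1 i).
    by rewrite (ord1 ord_max) !tnth_cons_pair0 !ltW.
  by rewrite -(borel_volume_fineK mC Cb) lee_fin leNgt sv.
have [a0 HA] := initial _ mA A0 Ab Ad Apos.
have [b0 HB] := initial _ mB B0 Bb Bd Bpos.
move: (fine (borel_volume R 1 A)) (fine (borel_volume R 1 B)) a0 b0 HA HB.
move=> a b a0 b0 HA HB.
set M := weighted_mean c d e a b.
have M0 : 0 < M by exact: weighted_mean_gt0.
rewrite borel_volume_slice1//.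
apply: (@le_trans _ _ (mu `]0, M[%classic)).
  by rewrite lebesgue_measure_itv/= lte_fin M0 -EFinB subr0.
apply: le_measure; rewrite ?inE//; first exact: measurable_slice1.
move=> x /=; rewrite in_itv/= => /andP[x0 xM].
pose k := x / M; have k0 : 0 < k by rewrite divr_gt0.
have k1 : k < 1 by rewrite ltr_pdivrMr// mul1r.
have ka : 0 < k * a < a by rewrite mulr_gt0//= gtr_pMl.
have kb : 0 < k * b < b by rewrite mulr_gt0//= gtr_pMl.
have := H _ _ (HA _ ka) (HB _ kb) _ _.
have -> : mean_tuple c d (fun=> e) (cons_pair (k * a, [tuple])) (cons_pair (k * b, [tuple])) =
    cons_pair (x, [tuple]).
  apply/eq_from_tnth => i; rewrite tnth_mktuple (ord1 i) !tnth_cons_pair0.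
  by rewrite weighted_meanZ// -/M divfK// gt_eqF.
by apply=> i; rewrite (ord1 i) tnth_cons_pair0; [case/andP: ka|case/andP: kb].
Qed.

Lemma tail_mean_ge0 (c d : R) e S a b : 0 <= a -> 0 <= b ->
  0 <= tail_mean c d e S a b.
Proof.
move=> a0 b0; case: e => [r| |] /=.
- case: ifP => _; first by rewrite mulr_ge0 ?powR_ge0.
  by case: ifP => _; rewrite ?powR_ge0// le_min !mulr_ge0 ?powR_ge0.
- by case: ifP => _; rewrite ?powR_ge0// le_max a0.
- by rewrite le_min !mulr_ge0 ?powR_ge0.
Qed.

(** The volumes of the slices satisfy the hypothesis of the inequality on the
    line, by the inequality for one coordinate fewer and tail_mean_step. Since G
    is any Borel set that contains the means, all the slice volumes are
    measurable. *)
Lemma curvilinear_volume n (c d : R) e (r : nat -> R) (A B G : set (n.+1.-tuple R)) :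
  0 < c -> 0 < d -> (e = 0%E -> c + d = 1) ->
  (forall i, (i < n)%N -> 0 < r i <= 1) ->
  measurable A -> measurable B -> measurable G ->
  nonneg_tuples A -> nonneg_tuples B -> bounded_tuples A -> bounded_tuples B ->
  last_downward_closed A -> last_downward_closed B ->
  (0 < borel_volume R n.+1 A)%E -> (0 < borel_volume R n.+1 B)%E ->
  absorbs_means c d (mean_exponent n r e) A B G ->
  ((tail_mean c d e (\sum_(i < n) (r i)^-1)
     (fine (borel_volume R n.+1 A)) (fine (borel_volume R n.+1 B)))%:E
    <= borel_volume R n.+1 G)%E.
Proof.
move=> c0 d0 ecd; elim: n r A B G => [|n IH] r A B G r01 mA mB mG A0 B0 Ab Bb Ad Bd Apos Bpos H.
  rewrite big_ord0 tail_mean0; last 2 first.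
  - exact: (fine_borel_volume_gt0 mA Ab Apos).
  - exact: (fine_borel_volume_gt0 mB Bb Bpos).
  by apply: curvilinear_volume1 => //; exact: H.
have a0 := fine_borel_volume_gt0 mA Ab Apos.
have b0 := fine_borel_volume_gt0 mB Bb Bpos.
pose f x := fine (borel_volume R n.+1 (slice A x)).
pose g x := fine (borel_volume R n.+1 (slice B x)).
pose h x := borel_volume R n.+1 (slice G x).
have fE (C : set (n.+2.-tuple R)) x : measurable C -> bounded_tuples C ->
    (fine (borel_volume R n.+1 (slice C x)))%:E = borel_volume R n.+1 (slice C x).
  by move=> mC Cb; rewrite borel_volume_fineK//; [exact: measurable_slice|exact: bounded_slice].
have mf (C : set (n.+2.-tuple R)) : measurable C -> bounded_tuples C ->
    measurable_fun setT (fun x => fine (borel_volume R n.+1 (slice C x))).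
  by move=> mC Cb; apply: measurableT_comp => //; exact: measurable_slice_volume.
have fN (C : set (n.+2.-tuple R)) x : nonneg_tuples C -> x < 0 ->
    fine (borel_volume R n.+1 (slice C x)) = 0.
  move=> C0 x0; have -> : slice C x = set0; last by rewrite measure0.
  apply/seteqP; split => // u /C0 /(_ ord0); rewrite tnth_cons_pair0.
  by rewrite leNgt x0.
have intf (C : set (n.+2.-tuple R)) : measurable C -> bounded_tuples C ->
    (\int[mu]_x (fine (borel_volume R n.+1 (slice C x)))%:E =
     (fine (borel_volume R n.+2 C))%:E)%E.
  move=> mC Cb; rewrite borel_volume_fineK// borel_volume_slice.
  by apply: eq_integral => x _; rewrite fE.
have /andP[r0 r1] := r01 0%N isT.
have s1 : 1 <= (r 0%N)^-1 by rewrite -(invr1 R) lef_pV2 ?posrE.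
rewrite [leRHS]borel_volume_slice.
apply: (@curvilinear_line R c d (r 0%N)^-1 _ _ _ f g h c0 d0 s1 a0 b0).
- exact: (tail_mean_ge0 _ _ _ _ (ltW a0) (ltW b0)).
- exact: mf.
- exact: mf.
- exact: measurable_slice_volume.
- by move=> x; apply: fine_ge0; exact: measure_ge0.
- by move=> x; apply: fine_ge0; exact: measure_ge0.
- by move=> x; exact: measure_ge0.
- by move=> x; exact: fN.
- by move=> x; exact: fN.
- exact: intf.
- exact: intf.
move=> x y x0 y0 fx gy.
have Sigma0 : 0 <= \sum_(i < n) (r i.+1)^-1.
  apply: sumr_ge0 => i _; rewrite invr_ge0 ltW//.
  by have /andP[] := r01 i.+1 (ltn_ord i).
have s0 : 0 < (r 0%N)^-1 by rewrite invr_gt0.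
have step := tail_mean_step c0 d0 ecd Sigma0 s0 fx gy a0 b0.
rewrite big_ord_recl addrC.
apply: (@le_trans _ _ ((tail_mean c d e (\sum_(i < n) (r i.+1)^-1) (f x) (g y))%:E *
  (wmean c d (r 0%N)^-1 (fine (borel_volume R n.+2 A) / f x)
     (fine (borel_volume R n.+2 B) / g y))%:E)%E).
  by rewrite -EFinM lee_fin.
apply: lee_wpmul2r; first by rewrite lee_fin powR_ge0.
rewrite -(weighted_meanE c d r0 x0 y0).
have Hs : absorbs_means c d (mean_exponent n (fun i => r i.+1) e)
    (slice A x) (slice B y) (slice G (weighted_mean c d (r 0%N)%:E x y)).
  exact: (absorbs_means_slice x0 y0 H).
apply: (IH (fun i => r i.+1)) => //.
- by move=> i ni; exact: r01.
- exact: measurable_slice.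
- exact: measurable_slice.
- exact: measurable_slice.
- exact: nonneg_slice.
- exact: nonneg_slice.
- exact: bounded_slice.
- exact: bounded_slice.
- exact: last_downward_closed_slice.
- exact: last_downward_closed_slice.
- by rewrite -fE// lte_fin.
- by rewrite -fE// lte_fin.
Qed.
End slices.

(** * The L_p curvilinear sum *)

Section lp_sum.
Context {R : realType}.

Lemma compression_last_downward_closed n (A : set (n.+1.-tuple R)) :
  A = compression A -> last_downward_closed A.
Proof.
move=> AE x y; rewrite AE => -[u [s [xE ne s0 sV]]] xy /andP[y0 yx].
have last (v : n.-tuple R) (w : R) : tnth [tuple of rcons v w] ord_max = w.
  by rewrite (tnth_nth w) /= nth_rcons size_tuple ltnn eqxx.
exists u, (tnth y ord_max); split => //.
  apply/eq_from_tnth => i; have [->|im] := eqVneq i ord_max; first by rewrite last.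
  rewrite xy// xE !(tnth_nth s) /= !nth_rcons size_tuple.
  suff -> : (i < n)%N by [].
  by rewrite ltn_neqAle -ltnS ltn_ord andbT; apply: contra im => /eqP im; apply/eqP/val_inj.
by apply: le_trans sV; rewrite lee_fin; move: yx; rewrite xE last.
Qed.

Lemma mean_exponentE n (alpha : 'I_n.+1 -> \bar R) (i : 'I_n.+1) :
  (forall i, i != ord_max -> (0 < alpha i <= 1)%E) ->
  alpha i = mean_exponent n (fun j => fine (alpha (inord j))) (alpha ord_max) i.
Proof.
move=> halpha; rewrite /mean_exponent inord_val; case: ifPn => [ni|]; last first.
  rewrite -leqNgt => ni; congr alpha; apply/val_inj => /=.
  by apply/eqP; rewrite eqn_leq -ltnS ltn_ord.
have im : i != ord_max by apply: contraTneq ni => ->; rewrite ltnn.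
have /andP[a0 a1] := halpha _ im; rewrite fineK// fin_real//.
by rewrite (lt_trans _ a0)//= (le_lt_trans a1)// ltry.
Qed.

(** The volume of the sum is an outer measure, hence the infimum of the volumes
    of the Borel sets that contain it; one fixed l already gives the bound. *)
Lemma lp_sum_volume n (p t l : R) (alpha : 'I_n.+1 -> \bar R)
    (A B : set (n.+1.-tuple R)) :
  let r j := fine (alpha (inord j)) in
  let c := lp_coefC p l t in let d := lp_coefD p l t in
  0 < t < 1 -> 0 < l < 1 ->
  (alpha ord_max = 0%E -> c + d = 1) ->
  (forall i, i != ord_max -> (0 < alpha i <= 1)%E) ->
  nonneg_tuples A -> nonneg_tuples B -> bounded_tuples A -> bounded_tuples B ->
  measurable A -> measurable B -> (0 < volume A)%E -> (0 < volume B)%E ->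
  A = compression A -> B = compression B ->
  ((tail_mean c d (alpha ord_max) (\sum_(i < n) (r i)^-1)
     (fine (volume A)) (fine (volume B)))%:E
   <= volume (lp_curvilinear_sum p t alpha A B))%E.
Proof.
move=> r c d /andP[t0 t1] l01 ecd halpha A0 B0 Ab Bb mA mB Apos Bpos Ac Bc.
have /andP[l0 l1] := l01.
have c0 : 0 < c by rewrite mulr_gt0 ?powR_gt0// subr_gt0.
have d0 : 0 < d by rewrite mulr_gt0 ?powR_gt0.
move: Apos Bpos; rewrite (volume_Borel mA) (volume_Borel mB) => Apos Bpos.
apply: le_ereal_inf_tmp => _ [F FC <-].
have mF := cover_measurable FC; have sF := cover_subset FC.
have mUF : measurable (\bigcup_k F k) by exact: bigcupT_measurable.
apply: (@le_trans _ _ (borel_volume R n.+1 (\bigcup_k F k))); last first.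
  exact: measure_sigma_subadditive.
apply: curvilinear_volume => //.
- move=> i ni; have iE : inord i = i :> nat := inordK (leqW ni).
  have im : inord i != ord_max :> 'I_n.+1 by rewrite -val_eqE /= iE ltn_eqF.
  have := halpha _ im; rewrite (mean_exponentE (inord i) halpha) /mean_exponent.
  by rewrite iE ni lte_fin lee_fin.
- exact: compression_last_downward_closed.
- exact: compression_last_downward_closed.
move=> x y Ax By x0 y0; apply: sF; exists l; first by rewrite /= in_itv.
exists x => //; exists y => //; apply/eq_from_tnth => i; rewrite !tnth_mktuple.
by rewrite -(mean_exponentE i halpha).
Qed.

Implicit Types (a b c d p t l s : R).

Lemma lp_coef_diag p t : 0 < t < 1 ->
  lp_coefC p t t = 1 - t /\ lp_coefD p t t = t.
Proof.
move=> /andP[t0 t1]; have t1' : 0 < 1 - t by rewrite subr_gt0.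
have E w : 0 < w -> w `^ p^-1 * w `^ (1 - p^-1) = w.
  by move=> w0; rewrite -powRD ?(gt_eqF w0) ?implybT// subrKC powRr1// ltW.
by rewrite /lp_coefC /lp_coefD !E.
Qed.

(** The equality case of Hoelder's inequality: l is the share of the second
    term in the sum (1 - t) a^(p/s) + t b^(p/s). *)
Lemma optimal_weights p t s a b : 1 <= p -> 0 < t < 1 -> 0 < s -> 0 < a -> 0 < b ->
  exists2 l, 0 < l < 1 &
    wmean (lp_coefC p l t) (lp_coefD p l t) s a b = power_mean t (p / s)%:E a b.
Proof.
move=> p1 /andP[t0 t1] s0 a0 b0; have t1' : 0 < 1 - t by rewrite subr_gt0.
have p0 : 0 < p by exact: lt_le_trans p1.
pose x := (1 - t) * a `^ (p / s); pose y := t * b `^ (p / s).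
have x0 : 0 < x by rewrite mulr_gt0// powR_gt0.
have y0 : 0 < y by rewrite mulr_gt0// powR_gt0.
have [xE yE] : x = (1 - t) * a `^ (p / s) /\ y = t * b `^ (p / s) by [].
clearbody x y; have xy0 : 0 < x + y by exact: addr_gt0.
exists (y / (x + y)).
  by rewrite divr_gt0//= ltr_pdivrMr// mul1r ltrDr.
have E (w u v : R) : 0 < w -> 0 < u -> 0 < v -> v = w * u `^ (p / s) ->
    w `^ p^-1 * (v / (x + y)) `^ (1 - p^-1) * u `^ s^-1 = v * (x + y) `^ (p^-1 - 1).
  move=> w0 u0 v0 vE.
  have -> : w `^ p^-1 * (v / (x + y)) `^ (1 - p^-1) * u `^ s^-1 =
      (w `^ p^-1 * u `^ s^-1) * (v / (x + y)) `^ (1 - p^-1) by rewrite mulrAC.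
  have -> : w `^ p^-1 * u `^ s^-1 = v `^ p^-1.
    rewrite vE powRM ?powR_ge0 ?(ltW w0)// -powRrM; congr (_ * _ `^ _).
    by rewrite mulrAC divff ?mul1r// gt_eqF.
  have xyV0 : 0 <= (x + y)^-1 by rewrite invr_ge0 ltW.
  rewrite (powRM _ (ltW v0) xyV0) mulrA -powRD ?(gt_eqF v0) ?implybT// subrKC.
  rewrite powRr1 ?(ltW v0)//; congr (_ * _).
  by rewrite -(powR_inv1 (ltW xy0)) -powRrM mulN1r opprB.
rewrite /power_mean /weighted_mean mulf_eq0 (gt_eqF a0) (gt_eqF b0) /=.
rewrite (gt_eqF (divr_gt0 p0 s0)) -xE -yE /wmean /lp_coefC /lp_coefD.
have -> : 1 - y / (x + y) = x / (x + y) by field; rewrite gt_eqF.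
rewrite (E _ _ _ t1' a0 x0 xE) (E _ _ _ t0 b0 y0 yE) -mulrDl.
have -> : (x + y) * (x + y) `^ (p^-1 - 1) = (x + y) `^ p^-1.
  rewrite -[X in X * _](powRr1 (ltW xy0)) -powRD ?(gt_eqF xy0) ?implybT//.
  by rewrite subrKC.
by rewrite -powRrM invf_div mulrC.
Qed.

(** Power means increase with the exponent. This instance is the reverse Hoelder
    inequality with one of the factors a mean of 1 and 1. *)
Lemma power_mean_neg_le p t s a b : 1 <= p -> 0 < t < 1 -> s < 0 ->
  0 < a -> 0 < b -> power_mean t (p / s)%:E a b <= wmean (1 - t) t s a b.
Proof.
move=> p1 /andP[t0 t1] s0 a0 b0; have t1' : 0 < 1 - t by rewrite subr_gt0.
have p0 : 0 < p by exact: lt_le_trans p1.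
have ps : p / s != 0 by rewrite mulf_eq0 invr_eq0 (gt_eqF p0) (lt_eqF s0).
have -> : power_mean t (p / s)%:E a b = wmean (1 - t) t (s / p) a b.
  rewrite /power_mean /weighted_mean mulf_eq0 (gt_eqF a0) (gt_eqF b0) (negbTE ps)/=.
  by rewrite /wmean (invf_div p s) (invf_div s p).
move: p1; rewrite le_eqVlt => /predU1P[<-|p1]; first by rewrite divr1.
have k0 : 0 < s / p - s.
  by rewrite subr_gt0 ltr_nMr// invf_lt1.
have sk : s + (s / p - s) < 0 by rewrite subrKC nmulr_rlt0// invr_gt0.
have := wmean_hoelder_neg t1' t0 k0 sk a0 b0 a0 b0.
rewrite subrKC !divff ?gt_eqF//.
have -> : wmean (1 - t) t (s / p - s) 1 1 = 1.
  by rewrite /wmean !powR1 !mulr1 subrK powR1.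
by rewrite mulr1.
Qed.
(** The choice of l. If the total s of the reciprocals of the exponents is
    positive and the bound is a power mean, the best l turns it into the mean of
    exponent p / s; if s is negative, l = t gives the mean of exponent 1 / s,
    which dominates that of exponent p / s; if the last exponent is 0 or s = 0,
    l = t gives the bound itself. When the bound is a minimum with s > 0, it is
    kept for every l. *)
Lemma bounds_of_tail_mean_bounds (p t S a b : R) (e V : \bar R) :
  1 <= p -> 0 < t < 1 -> 0 < S -> 0 < a -> 0 < b ->
  (forall l, 0 < l < 1 -> (e = 0%E -> lp_coefC p l t + lp_coefD p l t = 1) ->
    ((tail_mean (lp_coefC p l t) (lp_coefD p l t) e S a b)%:E <= V)%E) ->
  let s := (S%:E + recip e)%E in
  let g := if s == 0%E then -oo%E else recip s in
  ((- recip S%:E <= e)%E -> ((power_mean t (p%:E * g) a b)%:E <= V)%E) /\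
  ((e < - recip S%:E)%E ->
    (ereal_sup [set Order.min ((lp_coefC p l t `^ (fine g)^-1)%:E * a%:E)
                              ((lp_coefD p l t `^ (fine g)^-1)%:E * b%:E)
               | l in `]0%R, 1%R[%classic] <= V)%E).
Proof.
move=> hp ht S0 a0 b0 key s g; rewrite {}/g {}/s.
have [Ct Dt] := lp_coef_diag p ht.
have keyt : ((tail_mean (1 - t) t e S a b)%:E <= V)%E.
  by have := key t ht; rewrite Ct Dt subrK; apply.
have p0 : 0 < p by exact: lt_le_trans hp.
have recE (s : R) : s != 0 -> recip s%:E = (s^-1)%:E.
  by move=> s0; rewrite /recip inver (negbTE s0).
rewrite (recE _ (lt0r_neq0 S0)) -EFinN.
have optimal s : 0 < s -> (forall c d, tail_mean c d e S a b = wmean c d s a b) ->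
    e <> 0%E -> ((power_mean t (p%:E * (s^-1)%:E) a b)%:E <= V)%E.
  move=> s0 tailE e0; have [l l01 <-] := optimal_weights hp ht s0 a0 b0.
  by rewrite -tailE; apply: key.
have sup_le s : (forall c d, tail_mean c d e S a b = Num.min (c `^ s * a) (d `^ s * b)) ->
    e <> 0%E ->
    (ereal_sup [set Order.min ((lp_coefC p l t `^ s)%:E * a%:E)
                              ((lp_coefD p l t `^ s)%:E * b%:E)
               | l in `]0%R, 1%R[%classic] <= V)%E.
  move=> tailE e0; apply: ge_ereal_sup => _ [l l01 <-].
  have l01' : 0 < l < 1 by move: l01; rewrite /= in_itv.
  by rewrite -!EFinM -EFin_min -tailE; apply: key.
case: e key keyt optimal sup_le => [u| |] key keyt optimal sup_le.
- rewrite lee_fin lte_fin; have [u0|u0] := eqVneq u 0.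
    rewrite u0 /recip inve0 addey//= mule0; split.
      move=> _; move: keyt; rewrite /tail_mean u0 eqxx /power_mean /weighted_mean.
      by rewrite mulf_eq0 (gt_eqF a0) (gt_eqF b0) /= eqxx.
    by rewrite oppr_gt0 invr_lt0 ltNge (ltW S0).
  rewrite (recE _ u0) -EFinD eqe.
  have un0 : u%:E <> 0%E by move=> [] /eqP; rewrite (negbTE u0).
  have [uP|uN] := ltP 0 u.
    have s0 : 0 < u^-1 + S by rewrite addr_gt0 ?invr_gt0.
    rewrite (addrC S) (gt_eqF s0) (recE _ (lt0r_neq0 s0)); split; last first.
      move=> uS; have := lt_trans uP uS.
      by rewrite oppr_gt0 invr_lt0 ltNge (ltW S0).
    move=> _; apply: optimal => // c d.
    by rewrite /= (negbTE u0) ltNge (ltW uP).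
  have {}uN : u < 0 by rewrite lt_neqAle u0.
  have thr : (- S^-1 <= u) = (u^-1 + S <= 0).
    by rewrite -lef_nV2 ?negrE ?oppr_lt0 ?invr_gt0// invrN invrK -subr_le0 opprK.
  rewrite ltNge thr -ltNge (addrC S); split => us.
    case: eqVneq => [s0|s0].
      rewrite gt0_muleNy ?lte_fin// /power_mean /weighted_mean mulf_eq0 (gt_eqF a0) (gt_eqF b0).
      by move: keyt; rewrite /= (negbTE u0) uN s0 lexx !powRr0 !mul1r.
    have {us}s0' : u^-1 + S < 0 by rewrite lt_neqAle s0.
    rewrite (recE _ s0) -EFinM; apply: le_trans keyt.
    by rewrite lee_fin /= (negbTE u0) uN (leNgt 0) s0' power_mean_neg_le.
  rewrite (gt_eqF us) (recE _ (lt0r_neq0 us)) /= invrK; apply: sup_le => // c d.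
  by rewrite /= (negbTE u0) uN (ltW us).
- rewrite [recip +oo%E]/recip adde0 eqe (gt_eqF S0) (recE _ (lt0r_neq0 S0)); split => //.
  by move=> _; apply: optimal => // c d; rewrite /= (gt_eqF S0).
- rewrite [recip -oo%E]/recip adde0 eqe (gt_eqF S0) (recE _ (lt0r_neq0 S0)); split => //= _.
  by rewrite invrK; apply: sup_le.
Qed.

End lp_sum.

Theorem theorem1p1 (R : realType) (n : nat) (hn : (1 <= n)%N)
    (p t : R) (hp : 1 <= p) (ht : 0 < t < 1)
    (alpha : 'I_n.+1 -> \bar R)
    (halpha : forall i, i != ord_max -> (0 < alpha i <= 1)%E)
    (A B : set (n.+1.-tuple R))
    (A_ge0 : forall x, A x -> forall i, 0 <= tnth x i)
    (B_ge0 : forall x, B x -> forall i, 0 <= tnth x i)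
    (A_bounded : bounded_tuples A) (B_bounded : bounded_tuples B)
    (A_Borel : measurable A) (B_Borel : measurable B)
    (A_pos : (0 < volume A)%E) (B_pos : (0 < volume B)%E)
    (A_compr : A = compression A) (B_compr : B = compression B) :
  let threshold := (- recip (\sum_(i < n.+1 | i != ord_max) recip (alpha i)))%E in
  let g := gamma_exponent alpha in
  ((threshold <= alpha ord_max)%E ->
    ((power_mean t (p%:E * g) (fine (volume A)) (fine (volume B)))%:E
       <= volume (lp_curvilinear_sum p t alpha A B))%E) /\
  ((alpha ord_max < threshold)%E ->
    (ereal_sup [set Order.min
                      ((lp_coefC p l t `^ (fine g)^-1)%:E * volume A)
                      ((lp_coefD p l t `^ (fine g)^-1)%:E * volume B)
               | l in `]0%R, 1%R[%classic]
       <= volume (lp_curvilinear_sum p t alpha A B))%E).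
Proof.
set r := fun j : nat => fine (alpha (inord j)).
pose S := \sum_(i < n) (r i)^-1.
have alphaE (i : 'I_n) : alpha (widen_ord (leqnSn n) i) = (r i)%:E /\ 0 < r i.
  have im : widen_ord (leqnSn n) i != ord_max.
    by rewrite -val_eqE /= ltn_eqF.
  have aE : alpha (widen_ord (leqnSn n) i) = (r i)%:E.
    by rewrite (mean_exponentE _ halpha) /mean_exponent /= ltn_ord.
  by have := halpha _ im; rewrite aE lte_fin => /andP[].
have S0 : 0 < S.
  rewrite /S (bigD1 (Ordinal hn))//= ltr_pwDl//.
    by rewrite invr_gt0; exact: (alphaE (Ordinal hn)).2.
  by apply: sumr_ge0 => i _; rewrite invr_ge0 ltW// (alphaE i).2.
have sumE : (\sum_(i < n.+1 | i != ord_max) recip (alpha i) = S%:E)%E.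
  rewrite big_mkcond big_ord_recr /= eqxx adde0 /S -sumEFin.
  apply: eq_bigr => i _; have [-> ri] := alphaE i.
  by rewrite -val_eqE /= ltn_eqF //= /recip inver gt_eqF.
have sumT : (\sum_(i < n.+1) recip (alpha i) = S%:E + recip (alpha ord_max))%E.
  rewrite big_ord_recr /=; congr (_ + _)%E.
  rewrite -sumE [RHS]big_mkcond [RHS]big_ord_recr /= eqxx adde0.
  by apply: eq_bigr => i _; rewrite -val_eqE /= ltn_eqF.
have fA : (fine (volume A))%:E = volume A by rewrite fineK// volume_bounded.
have fB : (fine (volume B))%:E = volume B by rewrite fineK// volume_bounded.
have a0 : 0 < fine (volume A) by rewrite -lte_fin fA.
have b0 : 0 < fine (volume B) by rewrite -lte_fin fB.
have key l : 0 < l < 1 -> (alpha ord_max = 0%E -> lp_coefC p l t + lp_coefD p l t = 1) ->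
    ((tail_mean (lp_coefC p l t) (lp_coefD p l t) (alpha ord_max) S
      (fine (volume A)) (fine (volume B)))%:E
     <= volume (lp_curvilinear_sum p t alpha A B))%E.
  by move=> l01 ecd; apply: lp_sum_volume.
move: (fine (volume A)) (fine (volume B)) fA fB a0 b0 key => a b fA fB a0 b0 key.
rewrite /= sumE /gamma_exponent sumT -{}fA -{}fB.
exact: bounds_of_tail_mean_bounds.
Qed.
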